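(* Consider a generalized linear mixed model for $y=(y_1,\dots,y_N)$ with parameter vector $\theta=(\theta_c)_{1\le c\le d}$, parameter space $\Theta$ a convex subset of $\mathbb{R}^d$, true parameter vector $\theta_0$, and subsets of the data with clusters $y_{a,j}$, $1\le j\le m_a$, $1\le a\le b$, as described in the context. Suppose that: (A1) for each $1\le a\le b$, the vectors $y_{a,j}$, $1\le j\le m_a$, are independent, with $m_a\to\infty$ as $N\to\infty$; (B2) $\theta_0\in\Theta^{\mathrm{o}}$, the interior of $\Theta$, and there is $0<M<\infty$ (the same as in (B3) below) such that, for every $\varepsilon>0$, $$\limsup_{N\to\infty}\ \sup_{\theta\in\Theta,\ \varepsilon\le|\theta-\theta_0|\le M}\ \min_{1\le a\le b}\frac{1}{m_a}\sum_{j=1}^{m_a}\mathrm{E}_{\theta_0}\left[\log\left\{\frac{p_\theta(y_{a,j})}{p_{\theta_0}(y_{a,j})}\right\}\right]<0;$$ (B3) there are positive constant sequences $s_N$, $s_{a,N}$, $1\le a\le b$, such that $$\sup_{\theta\in\Theta,\ |\theta-\theta_0|\le M}\ \max_{1\le c\le d}\left|\frac{\partial}{\partial\theta_c}\log\{p_\theta(y)\}\right|=O_{\mathrm{P}}(s_N)\quad\text{with}\quad \frac{\log(s_N)}{\min_{1\le a\le b}m_a}\to 0,$$ and, for each $1\le a\le b$, $$\sup_{\theta\in\Theta,\ |\theta-\theta_0|\le M}\ \frac{1}{m_a}\sum_{j=1}^{m_a}\max_{1\le c\le d}\left|\frac{\partial}{\partial\theta_c}\log\{p_\theta(y_{a,j})\}\right|=o_{\mathrm{P}}(s_{a,N})\quad\text{with}\quad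 \frac{\log(s_{a,N})}{m_a}\to 0,$$ and (for the same $s_{a,N}$) $$\sup_{\theta\in\Theta,\ |\theta-\theta_0|\le M}\ \frac{s_{a,N}^{d-1}}{m_a^2}\sum_{j=1}^{m_a}\mathrm{var}_{\theta_0}\left[\log\left\{\frac{p_\theta(y_{a,j})}{p_{\theta_0}(y_{a,j})}\right\}\right]\longrightarrow 0,\qquad 1\le a\le b.$$ Then there is, with probability tending to $1$, a root $\hat\theta$ to the likelihood equation $\frac{\partial}{\partial\theta}\log p_\theta(y)=0$ such that $\hat\theta\stackrel{\mathrm{P}}{\longrightarrow}\theta_0$ as $N\to\infty$.
   Context: Generalized linear mixed model (GLMM). (i) Given a vector $u$ of random effects, responses $y_1,\dots,y_N$ are conditionally independent with conditional density, with respect to a $\sigma$-finite measure $\nu$, given by the exponential family $$f_i(y_i\mid u)=\exp\left[a_i^{-1}(\phi)\{y_i\xi_i-b(\xi_i)\}+c_i(y_i,\phi)\right],$$ where $\phi$ is a dispersion parameter (known in some cases), and $b(\cdot),a_i(\cdot),c_i(\cdot,\cdot)$ are known functions, continuously differentiable with respect to $\xi_i$ and $\phi$; the natural parameter $\xi_i$ is associated with the conditional mean $\mu_i=\mathrm{E}(y_i\mid u)$ according to the properties of the exponential family. (ii) $g(\mu_i)=x_i'\beta+z_i'u$, where $x_i,z_i$ are known vectors, $\beta$ is a vector of unknown parameters and $g(\cdot)$ is a link function. (iii) $u\sim N(0,G)$, where the covariance matrix $G$ may depend on a vector $\varphi$ of dispersion parameters. The vector of all unknown parameters is $\theta$, with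 parameter space $\Theta$ and true value $\theta_0$. The model (including the random effects and the known vectors) may vary with $N$, and asymptotics are as $N\to\infty$ with $\Theta$ and $\theta_0$ fixed. Subsets of the data. Let $b$ be a fixed positive integer (not the function $b(\cdot)$). For $1\le a\le b$, let $y_i^{(a)}$, $i=1,\dots,N_a$, be the $a$th subset of the data, and suppose there is a partition $\{1,\dots,N_a\}=\bigcup_{j=1}^{m_a}S_{a,j}$. Put $y_{a,j}=[y_i^{(a)}]_{i\in S_{a,j}}$. (The subsets, $N_a$, $m_a$ and the partitions may depend on $N$.) Let $p_\theta(y_{a,j})$ denote the (marginal) probability density function of $y_{a,j}$, with respect to $\nu$ (or the product measure induced by $\nu$ if $y_{a,j}$ is multivariate), when $\theta$ is the true parameter vector. Likewise $p_\theta(y)$ is the density of the full data $y=(y_i)_{1\le i\le N}$ under $\theta$. The independence in (A1) is under every $\theta\in\Theta$. $\mathrm{P}_\theta,\mathrm{E}_\theta,\mathrm{var}_\theta$ denote probability, expectation and variance when $\theta$ is the true parameter vector. $O_{\mathrm{P}}$, $o_{\mathrm{P}}$, convergence in probability and ''probability tending to $1$'' are under $\mathrm{P}_{\theta_0}$ as $N\to\infty$. It is implicit in (B3) that the partial derivatives appearing there exist. $|\cdot|$ is the Euclidean norm on $\mathbb{R}^d$; the supremum over an empty set is $-\infty$.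
   Formalization: When d > 1, each sequence s_{a,N} is additionally assumed to be eventually bounded below by a positive constant; without this the claim fails, since s_{a,N} → 0 makes the variance condition in (B3) too weak for a law of large numbers. *)

(* Defs.v *)
From HB Require Import structures.
From mathcomp Require Import all_boot all_order all_algebra.
From mathcomp Require Import all_classical all_reals all_analysis.
Set Implicit Arguments.
Unset Strict Implicit.
Unset Printing Implicit Defensive.
Import Order.TTheory GRing.Theory Num.Theory.
Import numFieldNormedType.Exports.
Local Open Scope classical_set_scope.
Local Open Scope ring_scope.

Section euclidean_space.
Context {R : realType} {d : nat}.
Implicit Types (A : set 'rV[R]_d) (F : 'rV[R]_d -> R) (x : 'rV[R]_d).

(* The library norm on 'rV_d is the sup norm. *)
Definition enorm x : R := Num.sqrt (\sum_(c < d) x 0 c ^+ 2).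

Definition unitv (c : 'I_d) : 'rV[R]_d := delta_mx 0 c.

(* Partial derivatives relative to a convex domain A: the increments h are
   restricted to x + h e_c \in A, so that at a boundary point of A the
   derivative is the one-sided one, and only the directions that do not leave A
   on both sides are considered.  In the interior of A every direction is
   admissible and these are the usual partial derivatives.                    *)
Definition admissible A x (c : 'I_d) : Prop :=
  exists h : R, h != 0 /\ A (x + h *: unitv c).

Definition partial_quotient F x c (h : R) : R :=
  h^-1 * (F (x + h *: unitv c) - F x).

Definition partial_nbhs A x (c : 'I_d) :=
  within [set h : R | A (x + h *: unitv c)] (0 : R)^'.

Definition has_partial A F x c : Prop :=
  cvg (partial_quotient F x c @ partial_nbhs A x c).

Definition partial A F x c : R :=
  lim (partial_quotient F x c @ partial_nbhs A x c).

Definition max_partial A F x : R :=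
  \big[Num.max/0]_(c < d | `[< admissible A x c >]) `|partial A F x c|.

End euclidean_space.

(* Defined through the one-dimensional projections, to allow a singular G; the
   library's normal_prob is not the Dirac mass when the variance is 0.        *)
Definition gaussian_vector {R : realType} {dT} {T : measurableType dT} {q : nat}
    (P : probability T R) (u : T -> q.-tuple R) (G : 'M[R]_q) : Prop :=
  G^T = G /\
  forall t : 'rV[R]_q,
    let s2 := (t *m G *m t^T) 0 0 in
    0 <= s2 /\
    forall B : set R, measurable B ->
      P [set w | B (\sum_(k < q) t 0 k * tnth (u w) k)] =
      if s2 == 0 then dirac (0 : R) B else normal_prob 0 (Num.sqrt s2) B.

Definition continuously_differentiable_on {R : realType} (A : set R)
    (f : R -> R) : Prop :=
  forall x, A x -> derivable f x 1 /\ {for x, continuous (derive1 f)}.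

(* theta = (beta, phi, varphi), where the coordinate phi is present only if the
   dispersion parameter phi is unknown (phi0 = None).                         *)
Definition glmm_dim {R : realType} (p : nat) (phi0 : option R) (r : nat) : nat :=
  (p + (~~ isSome phi0 + r))%N.

Section parameter.
Context {R : realType} {p r : nat} {phi0 : option R}.
Implicit Types theta : 'rV[R]_(glmm_dim p phi0 r).

Definition theta_beta theta : 'rV[R]_p := @lsubmx R 1 p (~~ isSome phi0 + r) theta.

Definition theta_phi theta : R :=
  match phi0 as o return 'rV[R]_(~~ isSome o) -> R with
  | Some v => fun=> v
  | None => fun w => w 0 0
  end (@lsubmx R 1 (~~ isSome phi0) r (@rsubmx R 1 p (~~ isSome phi0 + r) theta)).

Definition theta_varphi theta : 'rV[R]_r :=
  @rsubmx R 1 (~~ isSome phi0) r (@rsubmx R 1 p (~~ isSome phi0 + r) theta).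

End parameter.

(* A statistical experiment (Omega, (P_theta)) carrying the random effects u and
   the N responses y, together with the known ingredients of the model.       *)
Record glmm (R : realType) (dO : measure_display) (p : nat) (phi0 : option R)
    (r N : nat) := Glmm {
  sample : measurableType dO ;
  law : 'rV[R]_(glmm_dim p phi0 r) -> probability sample R ;
  nre : nat ;
  reff : {mfun sample >-> nre.-tuple R} ;
  resp : {mfun sample >-> N.-tuple R} ;
  nu : {sigma_finite_measure set R -> \bar R} ;
  adisp : 'I_N -> R -> R ;
  cumulant : R -> R ;
  cnorm : 'I_N -> R -> R -> R ;
  nat_dom : set R ;
  disp_dom : set R ;
  link : R -> R ;
  nat_par : R -> R ;
  xcov : 'I_N -> 'rV[R]_p ;
  zcov : forall i : 'I_N, 'rV[R]_nre ;
  re_cov : 'rV[R]_r -> 'M[R]_nre }.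

Section glmm_model.
Context {R : realType} {dO : measure_display} {p : nat} {phi0 : option R}
  {r N : nat}.
Variable m : glmm dO p phi0 r N.
Local Notation param := 'rV[R]_(glmm_dim p phi0 r).
Implicit Types (theta : param) (v : (nre m).-tuple R) (i : 'I_N).

Definition linear_predictor theta v i : R :=
  \sum_(k < p) xcov m i 0 k * theta_beta theta 0 k +
  \sum_(k < nre m) zcov m i 0 k * tnth v k.

(* xi_i is determined by g(b'(xi_i)) = x_i' beta + z_i' u, hence is a function
   of the linear predictor (see glmm_link).                                   *)
Definition xi theta v i : R := nat_par m (linear_predictor theta v i).

Definition cond_density theta v i (t : R) : R :=
  expR ((adisp m i (theta_phi theta))^-1 *
          (t * xi theta v i - cumulant m (xi theta v i))
        + cnorm m i t (theta_phi theta)).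

Definition cond_mean theta v i : R :=
  (\int[nu m]_t (t * cond_density theta v i t))%R.

Record is_glmm (Theta : set param) : Prop := IsGlmm {
  glmm_nat_dom : open (nat_dom m) ;
  glmm_disp_dom : open (disp_dom m) ;
  glmm_cumulant : continuously_differentiable_on (nat_dom m) (cumulant m) ;
  glmm_adisp : forall i, continuously_differentiable_on (disp_dom m) (adisp m i) ;
  glmm_cnorm : forall i t,
    continuously_differentiable_on (disp_dom m) (cnorm m i t) ;
  glmm_phi : forall theta, Theta theta -> disp_dom m (theta_phi theta) ;
  glmm_adisp_neq0 : forall theta i, Theta theta ->
    adisp m i (theta_phi theta) != 0 ;
  glmm_xi : forall theta v i, Theta theta -> nat_dom m (xi theta v i) ;
  glmm_density_measurable : forall theta i, Theta theta ->
    measurable_fun [set: (nre m).-tuple R * R]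
      (fun vt => cond_density theta vt.1 i vt.2) ;
  glmm_density_int1 : forall theta v i, Theta theta ->
    (\int[nu m]_t (cond_density theta v i t)%:E = 1)%E ;
  glmm_mean_integrable : forall theta v i, Theta theta ->
    (nu m).-integrable setT (fun t => (t * cond_density theta v i t)%:E) ;
  glmm_mean : forall theta v i, Theta theta ->
    cond_mean theta v i = derive1 (cumulant m) (xi theta v i) ;
  glmm_link : forall theta v i, Theta theta ->
    link m (cond_mean theta v i) = linear_predictor theta v i ;
  (* given u, the y_i are independent with densities f_i(. | u) *)
  glmm_cond_law : forall theta, Theta theta ->
    forall (A : set ((nre m).-tuple R)) (B : 'I_N -> set R),
      measurable A -> (forall i, measurable (B i)) ->
      law m theta (reff m @^-1` A `&` [set w | forall i, B i (tnth (resp m w) i)])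
      = (\int[law m theta]_(w in reff m @^-1` A)
           \prod_(i < N) \int[nu m]_(t in B i)
             (cond_density theta (reff m w) i t)%:E)%E ;
  glmm_reff : forall theta, Theta theta ->
    gaussian_vector (law m theta) (reff m) (re_cov m (theta_varphi theta)) }.

(* p_theta(y_C), the density of y_C = (y_i)_{i in C} with respect to the product
   of #|C| copies of nu, obtained by integrating the random effects out; it
   depends on y only through the coordinates in C.                            *)
Definition marginal_density (C : {set 'I_N}) theta (y : N.-tuple R) : \bar R :=
  (\int[distribution (law m theta) (reff m)]_v
     (\prod_(i in C) cond_density theta v i (tnth y i))%:E)%E.

Definition log_density C theta (y : N.-tuple R) : R :=
  ln (fine (marginal_density C theta y)).

Definition log_ratio C theta theta0 (y : N.-tuple R) : R :=
  ln (fine (marginal_density C theta y) / fine (marginal_density C theta0 y)).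

Definition subvector (C : {set 'I_N}) (y : N.-tuple R) : #|C|.-tuple R :=
  [tuple tnth y (enum_val k) | k < #|C|].

Definition independent_clusters (S : {set {set 'I_N}}) theta : Prop :=
  forall B : forall C : {set 'I_N}, set (#|C|.-tuple R),
    (forall C, measurable (B C)) ->
    law m theta [set w | forall C, C \in S -> B C (subvector C (resp m w))] =
    (\prod_(C in S) law m theta [set w | B C (subvector C (resp m w))])%E.

Definition log_density_has_partials (Theta : set param) C theta y : Prop :=
  marginal_density C theta y \is a fin_num /\
  forall c, admissible Theta theta c ->
    has_partial Theta (fun th => log_density C th y) theta c.

Definition score_norm (Theta : set param) C theta y : R :=
  max_partial Theta (fun th => log_density C th y) theta.

Definition likelihood_root (Theta : set param) (y : N.-tuple R) theta : Prop :=
  [/\ Theta° theta, marginal_density [set: 'I_N]%SET theta y \is a fin_num &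
      forall c, is_derive theta (unitv c) (fun th => log_density [set: 'I_N]%SET th y) 0].

End glmm_model.

(* The suprema over theta need not be measurable, hence the outer probability
   mu_ext.                                                                    *)
Section stochastic_order.
Context {R : realType} {disp : nat -> measure_display}
  {T : forall N, measurableType (disp N)} (P : forall N, probability (T N) R).
Local Open Scope ereal_scope.

Definition tends_to_zero_in_outer_probability (A : forall N, set (T N)) : Prop :=
  mu_ext (P N) (A N) @[N --> \oo] --> 0.

Definition with_probability_tending_to_one (A : forall N, set (T N)) : Prop :=
  tends_to_zero_in_outer_probability (fun N => ~` A N).

Definition bigO_P (X : forall N, T N -> \bar R) (s : nat -> R) : Prop :=
  forall eta : R, (0 < eta)%R -> exists K : R, \forall N \near \oo,
    mu_ext (P N) [set w | (K * s N)%:E < `|X N w|] <= eta%:E.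

Definition littleo_P (X : forall N, T N -> \bar R) (s : nat -> R) : Prop :=
  forall e : R, (0 < e)%R ->
    tends_to_zero_in_outer_probability
      (fun N => [set w | (e * s N)%:E < `|X N w|]).

End stochastic_order.

(* Main.v *)
Require Import Defs.
From HB Require Import structures.
From mathcomp Require Import all_boot all_order all_algebra.
From mathcomp Require Import all_classical all_reals all_analysis.
From mathcomp Require Import measurable_realfun.
From mathcomp Require Import ring lra.
Set Implicit Arguments.
Unset Strict Implicit.
Unset Printing Implicit Defensive.
Import Order.TTheory GRing.Theory Num.Theory.
Import numFieldNormedType.Exports.
Local Open Scope classical_set_scope.
Local Open Scope ring_scope.

(** Let rho > 0 be small and let Q be the cube of half-side rho centred at
theta0.  If the log-likelihood is smaller on the boundary of Q than at theta0,
then its maximum over Q is attained inside Q and is a root of the likelihood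
equation ([cube_critical_point]).  It is shown that this happens with
probability tending to one for every small rho ([likelihood_root_in_cube]).
Among the roots, the estimator picks one that is almost as close to theta0 as
possible; it does not depend on rho, and is therefore consistent.

The random effects make all the responses dependent, so that no law of large
numbers is at hand for the full log-likelihood.  Subsets of the data help in
the following way.  If p_theta denotes the density of y, then for every event E
that depends only on y,
   P_theta0(E and p_theta0(y) <= e^x p_theta(y)) <= e^x P_theta(E).
Take for E the event that the product of the cluster ratios
p_theta0(y_C) / p_theta(y_C) over a subset is at least e^c.  Under theta the
clusters are independent and every ratio has expectation at most 1, so that
P_theta(E) <= e^(-c) by the inequality of Markov.  Hence, up to an event of
probability e^(x - c), a large value of the likelihood ratio of the subset in
favour of theta0 forces the full likelihood to prefer theta0 as well
([subset_inequality]).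

It remains to see that the subsets do favour theta0, uniformly over the
boundary of Q.  At each point of the boundary, the mean of the average cluster
log-ratio is at most - delta for one of the subsets.  The averages are within
delta / 2 of their means on the whole boundary, with probability tending to
one ([avg_log_ratio_uniform]): Chebyshev is applied on a net of mesh about
1 / s_a, which has about s_a^(d - 1) points, and the bound on the scores
controls what happens between the points of the net.  The bound on the scores
holds in probability and not in expectation; still, it controls the oscillation
of the means, since with positive probability two averages are close to each
other and to their means.

Thus c is of the order of the number m_a of clusters.  A net of the boundary of
mesh about 1 / s_N has about s_N^(d - 1) points, which is e^(o(min m_a)), and
the union bound applies to it ([subexponential_net]).  Between the points of
this net the log-likelihood varies by at most 1, and this is absorbed by taking
x = 1. *)

(** * Integration against a weight *)

Section weight.
Local Open Scope ereal_scope.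
Context d1 d2 (T1 : measurableType d1) (T2 : measurableType d2) (R : realType).
Variables (m1 : {measure set T1 -> \bar R}) (m2 : {measure set T2 -> \bar R}).
Variables (phi : T1 -> T2) (W : T1 -> \bar R).
Hypotheses (mphi : measurable_fun setT phi) (mW : measurable_fun setT W).
Hypothesis W0 : forall x, 0 <= W x.
Hypothesis weightE : forall B, measurable B ->
  \int[m1]_(x in phi @^-1` B) W x = m2 B.

Import HBNNSimple.

(** Covers two situations: with phi the identity, W is the density of m2 with
respect to m1; with W independent of phi, m2 is a multiple of the law of phi.
The weight W may be infinite. *)
Lemma integral_comp_weight (h : T2 -> \bar R) :
  measurable_fun setT h -> (forall x, 0 <= h x) ->
  \int[m1]_x (h (phi x) * W x) = \int[m2]_x h x.
Proof.
move=> mh h0; pose g := nnsfun_approx measurableT mh.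
have gh x : EFin \o g^~ x @ \oo --> h x by exact: cvg_nnsfun_approx.
have g_le x n : (g n x)%:E <= h x.
  rewrite -(cvg_lim _ (gh x))//; apply: lime_ge.
    by apply/cvg_ex; exists (h x); exact: gh.
  near=> k; rewrite /= lee_fin; apply/lefP/nd_nnsfun_approx.
  by near: k; exists n.
have -> : \int[m2]_x h x = limn (fun n => \int[m2]_x (EFin \o g n) x).
  rewrite -monotone_convergence//.
  - by apply: eq_integral => x _; apply/esym/cvg_lim => //; exact: gh.
  - by move=> n; exact/measurable_EFinP.
  - by move=> n x _; rewrite lee_fin.
  - by move=> x _ a b ab; rewrite lee_fin; exact/lefP/nd_nnsfun_approx.
have -> : \int[m1]_x (h (phi x) * W x) =
    limn (fun n => \int[m1]_x ((EFin \o g n) (phi x) * W x)).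
  rewrite -monotone_convergence//.
  - apply: eq_integral => x _; apply/esym/cvg_lim => //.
    have [Wx0|Wx0] := eqVneq (W x) 0.
      rewrite Wx0 mule0 (_ : (fun _ => _) = cst 0); first exact: cvg_cst.
      by apply/funext => n; rewrite mule0.
    have [h0x|hx0] := eqVneq (h (phi x)) 0.
      rewrite (_ : (fun _ => _) = cst (h (phi x) * W x)); first exact: cvg_cst.
      apply/funext => n /=; congr (_ * _); apply/eqP.
      by rewrite eq_le; apply/andP; split; [exact: g_le|rewrite h0x lee_fin].
    apply: cvgeM; [ | exact: gh | exact: cvg_cst].
    move: hx0 Wx0 (W0 x) (h0 (phi x)); rewrite /mule_def.
    by case: (h _) => [s| |]//=; case: (W x).
  - move=> n; apply: emeasurable_funM => //.
    by apply/measurable_EFinP; exact: measurableT_comp.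
  - by move=> n x _; rewrite mule_ge0// lee_fin.
  - move=> x _ a b ab; rewrite lee_wpmul2r// lee_fin.
    exact/lefP/nd_nnsfun_approx.
suff suf n : \int[m1]_x ((EFin \o g n) (phi x) * W x) =
    \int[m2]_x (EFin \o g n) x.
  by under eq_fun do rewrite suf.
under [LHS]eq_integral.
  move=> x _; rewrite /= fimfunE -fsumEFin// ge0_mule_fsuml; last first.
    by move=> r; rewrite EFinM nnfun_muleindic_ge0.
  over.
under [RHS]eq_integral.
  move=> x _; rewrite /= fimfunE -fsumEFin//.
  over.
rewrite !ge0_integral_fsum//.
- apply: eq_fsbigr => r rg.
  have r0 : (0 <= r)%R by move: rg; rewrite inE => -[t _ <-].
  under [RHS]eq_integral do rewrite EFinM.
  rewrite integralZl_indic_nnsfun// integral_indic// setIT.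
  under eq_integral do rewrite EFinM -muleA.
  rewrite ge0_integralZl//.
  + rewrite -weightE//; congr (_ * _).
    rewrite [RHS]integral_mkcond; apply: eq_integral => x _.
    by rewrite muleC -[RHS]/((W \_ (phi @^-1` (g n @^-1` [set r]))) x) epatch_indic.
  + apply: emeasurable_funM => //; apply/measurable_EFinP.
    by apply: measurableT_comp => //; exact: measurable_indic.
  + by move=> x _; rewrite mule_ge0// lee_fin.
- by move=> r; apply/measurable_EFinP; apply: measurable_funM => //.
- by move=> r x _; rewrite EFinM nnfun_muleindic_ge0.
- move=> r; apply: emeasurable_funM => //; apply/measurable_EFinP.
  apply: measurable_funM => //.
  by apply: measurableT_comp => //; exact: measurable_indic.
- by move=> r x _; rewrite mule_ge0// EFinM nnfun_muleindic_ge0.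
Unshelve. all: by end_near. Qed.

End weight.

(** * Independent random variables *)

Section integral_and_products.
Local Open Scope ereal_scope.
Context d (T : measurableType d) (R : realType).

Lemma integral_indicT (m : {measure set T -> \bar R}) (A : set T) :
  measurable A -> \int[m]_x (\1_A x)%:E = m A.
Proof. by move=> mA; rewrite integral_indic// setIT. Qed.

Lemma emeasurable_prod (J : Type) (s : seq J) (Q : pred J)
    (f : J -> T -> \bar R) :
  (forall j, Q j -> measurable_fun setT (f j)) ->
  measurable_fun setT (fun x => \prod_(j <- s | Q j) f j x).
Proof.
move=> mf; elim: s => [|j s IH].
  by under eq_fun do rewrite big_nil; exact: measurable_cst.
have [Qj|Qj] := boolP (Q j); last first.
  by under eq_fun do rewrite big_cons (negbTE Qj).
under eq_fun do rewrite big_cons Qj.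
by apply: emeasurable_funM => //; exact: mf.
Qed.

Lemma prode_indic (J : finType) (Q : pred J) (b : J -> bool) :
  \prod_(i | Q i) ((b i)%:R)%:E = ([forall (i | Q i), b i]%:R)%:E :> \bar R.
Proof.
have [/forallP ball|/forallPn[i]] := boolP [forall (i | Q i), b i].
  by rewrite big1// => i Qi; have /implyP/(_ Qi) -> := ball i.
by rewrite negb_imply => /andP[Qi bi]; rewrite (bigD1 i)//= (negbTE bi) mul0e.
Qed.

End integral_and_products.

Section independence.
Local Open Scope ereal_scope.
Context d (T : measurableType d) (R : realType) (P : probability T R).
Context (I : finType) (S : {set I}) (Z : I -> {mfun T >-> R}).
Hypothesis indepZ : forall B : I -> set R, (forall i, measurable (B i)) ->
  P [set w | forall i, i \in S -> B i (Z i w)] =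
  \prod_(i in S) P (Z i @^-1` B i).

(** Induction on the number of functions that are not known to be indicators.
To free the function of index i, compare the measures
B |-> E[1_B(Z i) W] and B |-> P(Z i \in B) * E[W], where W is the product of the
other factors: they agree by induction. *)
Let integral_prod_seq (l : seq I) (h : I -> R -> \bar R) :
  (forall i, measurable_fun setT (h i)) -> (forall i x, 0 <= h i x) ->
  (forall i, i \in S -> \int[P]_w h i (Z i w) < +oo) ->
  (forall i, i \in S -> i \notin l ->
    exists2 B, measurable B & h i = EFin \o \1_B) ->
  \int[P]_w (\prod_(i in S) h i (Z i w)) =
  \prod_(i in S) \int[P]_w h i (Z i w).
Proof.
elim: l h => [|i l IH] h mh h0 hoo hind.
  have /choice[B BP] : forall i, exists B, measurable B /\
      (i \in S -> h i = EFin \o \1_B).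
    move=> i; have [iS|iS] := boolP (i \in S); last first.
      by exists setT; split => //.
    by have [B mB hB] := hind _ iS isT; exists B.
  transitivity (P [set w | forall i, i \in S -> B i (Z i w)]).
    rewrite (_ : [set w | _] = \bigcap_(i in [set` S]) (Z i @^-1` B i)); last first.
      by apply/seteqP; split => w.
    rewrite -integral_indicT//; last first.
      apply: fin_bigcap_measurable => //.
      by move=> i _; rewrite -[X in measurable X]setTI; apply: measurable_funPT; case: (BP i).
    apply: eq_integral => w _.
    rewrite (eq_bigr (fun i => ((Z i w \in B i)%:R)%:E)); last first.
      by move=> i iS; rewrite (BP i).2//= indicE.
    rewrite prode_indic indicE; congr (_%:R%:E); congr (nat_of_bool _).
    apply/idP/idP.
      by move=> /forall_inP BZ; rewrite inE => i /= /BZ; rewrite inE.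
    by rewrite inE => BZ; apply/forall_inP => i iS; rewrite inE; exact: BZ.
  rewrite indepZ; last by move=> i; case: (BP i).
  apply: eq_bigr => i iS; rewrite (BP i).2//=.
  rewrite -integral_indicT//; apply: measurable_funPTI; by case: (BP i).
have [iS|iS] := boolP (i \in S); last first.
  apply: IH => // j jS jl; apply: hind => //; rewrite inE negb_or jl andbT.
  by apply: contraNneq iS => <-.
under eq_integral do rewrite (bigD1 i)//=.
pose W w := \prod_(j in S | j != i) h j (Z j w).
pose c := \prod_(j in S | j != i) \int[P]_w h j (Z j w).
have E0 j : 0 <= \int[P]_w h j (Z j w) by apply: integral_ge0.
have c0 : 0 <= c by apply: prode_ge0.
have cfin : c \is a fin_num.
  rewrite /c; elim/big_rec : _ => // j x /andP[jS _] xfin.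
  by rewrite fin_numM// ge0_fin_numE// hoo.
have mW : measurable_fun setT W.
  apply: emeasurable_prod => j _.
  exact: measurableT_comp.
have W0 w : 0 <= W w by apply: prode_ge0.
pose k := NngNum (fine_ge0 c0).
rewrite (@integral_comp_weight _ _ _ _ _ P (mscale k (distribution P (Z i))) (Z i) W)//.
- rewrite ge0_integral_mscale// ge0_integral_distribution// [RHS](bigD1 i)//=.
  by rewrite fineK// muleC.
- move=> B mB.
  pose h' j := if j == i then EFin \o \1_B else h j.
  have h'i : h' i = EFin \o \1_B by rewrite /h' eqxx.
  have h'j j : j != i -> h' j = h j by rewrite /h' => /negbTE ->.
  have EB : \int[P]_w (EFin \o \1_B) (Z i w) = P (Z i @^-1` B).
    by rewrite -integral_indicT//; exact: measurable_funPTI.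
  have IHh : \int[P]_w (\prod_(j in S) h' j (Z j w)) =
      \prod_(j in S) \int[P]_w h' j (Z j w).
    apply: IH.
    - move=> j; rewrite /h'; case: ifP => // _.
      exact/measurable_EFinP/measurable_indic.
    - by move=> j x; rewrite /h'; case: ifP => // _; rewrite lee_fin.
    - move=> j jS; have [->|ji] := eqVneq j i; last by rewrite h'j// hoo.
      rewrite h'i EB (le_lt_trans (probability_le1 _ _))// ?ltry//.
      exact: measurable_funPTI.
    - move=> j jS jl; have [->|ji] := eqVneq j i; first by exists B.
      by rewrite h'j//; apply: hind => //; rewrite inE negb_or ji.
  rewrite (bigD1 i)//= h'i EB in IHh.
  have cE : \prod_(j in S | j != i) \int[P]_w h' j (Z j w) = c.
    by apply: eq_bigr => j /andP[_ ji]; rewrite h'j.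
  have WE w : \prod_(j in S) h' j (Z j w) = (EFin \o \1_B) (Z i w) * W w.
    rewrite (bigD1 i)//= h'i; congr (_ * _).
    by apply: eq_bigr => j /andP[_ ji]; rewrite h'j.
  rewrite cE in IHh; rewrite -[RHS]/((fine c)%:E * P (Z i @^-1` B)) fineK// muleC -IHh.
  rewrite integral_mkcond; apply: eq_integral => w _.
  by rewrite WE muleC epatch_indic.
Qed.

Lemma integral_prod_indep (h : I -> R -> \bar R) :
  (forall i, measurable_fun setT (h i)) -> (forall i x, 0 <= h i x) ->
  (forall i, i \in S -> \int[P]_w h i (Z i w) < +oo) ->
  \int[P]_w (\prod_(i in S) h i (Z i w)) =
  \prod_(i in S) \int[P]_w h i (Z i w).
Proof.
move=> mh h0 hoo; apply: (integral_prod_seq (l := enum I)) => //.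
by move=> i _; rewrite mem_enum.
Qed.

Lemma pairwise_indep (i j : I) (A B : set R) : i \in S -> j \in S -> i != j ->
  measurable A -> measurable B ->
  P (Z i @^-1` A `&` Z j @^-1` B) = P (Z i @^-1` A) * P (Z j @^-1` B).
Proof.
move=> iS jS ij mA mB.
pose C k := if k == i then A else if k == j then B else setT.
have := indepZ (B := C).
rewrite (_ : [set w | _] = Z i @^-1` A `&` Z j @^-1` B); last first.
  apply/seteqP; split => [w /= CZ|w /= [Aw Bw] k kS].
    have := CZ _ iS; have := CZ _ jS.
    by rewrite /C !eqxx eq_sym (negbTE ij).
  rewrite /C; case: ifPn => [/eqP ->//|_]; by case: ifPn => [/eqP ->|].
move=> ->; last by move=> k; rewrite /C; case: ifP => // _; case: ifP.
rewrite (bigD1 i)//= (bigD1 j)/=; last by rewrite jS eq_sym.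
rewrite {1 2}/C !eqxx eq_sym (negbTE ij) big1 ?mule1// => k /andP[/andP[kS ki] kj].
by rewrite /C (negbTE ki) (negbTE kj) preimage_setT probability_setT.
Qed.

End independence.

Section variance_sum.
Local Open Scope ereal_scope.
Context d (T : measurableType d) (R : realType) (P : probability T R).

(** The variance is defined through the centred variable X - fine 'E_P[X], which
makes sense whether or not X is integrable; that variable is square integrable,
and so is X. *)
Lemma Lfun2_variance (X : {mfun T >-> R}) :
  'V_P[X] < +oo -> (X : T -> R) \in Lfun P 2%:E.
Proof.
rewrite /variance unlock => Voo.
pose c := fine 'E_P[X]; pose Y := (X \- cst c)%R.
have mY : measurable_fun setT Y by exact: measurable_funB.
have Y2 : (Y : T -> R) \in Lfun P 2%:E.
  rewrite inE; apply/andP; split; rewrite inE//= /finite_norm unlock.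
  rewrite poweR_lty//; move: Voo; rewrite unlock; apply: le_lt_trans.
  apply: ge0_le_integral => //=.
  - apply/measurable_EFinP; apply/(@measurableT_comp _ _ _ _ _ _ (fun x : R => x `^ 2)%R) => //.
    exact/measurableT_comp.
  - by apply/measurable_EFinP; apply: measurable_funM; exact: measurable_funB.
  - move=> x _; rewrite lee_fin powR_mulrn// real_normK ?num_real// expr2.
    by rewrite /Y /c unlock.
rewrite (_ : (X : T -> R) = (Y \+ cst c)%R); last first.
  by apply/funext => x; rewrite /Y/= subrK.
by rewrite rpredD ?lee1n//= => _; exact: Lfun_cst.
Qed.

(** The joint law of X and Y is the product of their laws, so that Fubini
applies. *)
Lemma covariance_indep (X Y : {mfun T >-> R}) :
  (X : T -> R) \in Lfun P 2%:E -> (Y : T -> R) \in Lfun P 2%:E ->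
  (forall A B, measurable A -> measurable B ->
    P (X @^-1` A `&` Y @^-1` B) = P (X @^-1` A) * P (Y @^-1` B)) ->
  covariance P X Y = 0.
Proof.
move=> X2 Y2 XY.
have Pfin : P setT \is a fin_num := fin_num_measure P _ measurableT.
have X1 := Lfun_subset12 Pfin X2; have Y1 := Lfun_subset12 Pfin Y2.
have XY1 := Lfun2_mul_Lfun1 X2 Y2.
rewrite covarianceE//.
have Xi : P.-integrable setT (EFin \o X) by exact/Lfun1_integrable.
have Yi : P.-integrable setT (EFin \o Y) by exact/Lfun1_integrable.
have XYi : P.-integrable setT (EFin \o (X \* Y)%R) by exact/Lfun1_integrable.
pose Z w := (X w, Y w).
have mZ : measurable_fun setT Z by exact: measurable_fun_pair.
pose Zf : {mfun T >-> (R * R)%type} := HB.pack Z (isMeasurableFun.Build _ _ _ _ Z mZ).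
pose f (xy : R * R) := (xy.1 * xy.2)%:E.
have mf : measurable_fun setT f by apply/measurable_EFinP; exact: measurable_funM.
have E : \int[distribution P Zf]_xy f xy = 'E_P[X * Y].
  by rewrite integral_distribution// unlock.
have PE : forall C, measurable C ->
    (distribution P X \x distribution P Y) C = distribution P Zf C.
  by apply: product_measure_unique => A B mA mB; exact: XY.
have fint : (distribution P X \x distribution P Y).-integrable setT f.
  apply/integrableP; split => //.
  rewrite (eq_measure_integral (distribution P Zf)); last by move=> C mC _; exact: PE.
  rewrite ge0_integral_distribution//; last exact: measurableT_comp.
  by have /integrableP[] := XYi.
have EZ : \int[distribution P X \x distribution P Y]_xy f xy =
    \int[distribution P Zf]_xy f xy.
  by apply: eq_measure_integral => C mC _; exact: PE.
rewrite -E -EZ.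
rewrite -integral12_prod_meas1// /fubini_F /f/=.
have EY : \int[distribution P Y]_y y%:E = 'E_P[Y].
  by rewrite integral_distribution// unlock.
have EX : \int[distribution P X]_y y%:E = 'E_P[X].
  by rewrite integral_distribution// unlock.
have intY : (distribution P Y).-integrable setT EFin.
  exact: integrable_pushforward.
have intX : (distribution P X).-integrable setT EFin.
  exact: integrable_pushforward.
under eq_integral.
  move=> x _; under eq_integral do rewrite EFinM.
  rewrite integralZl// EY; over.
have EYfin := expectation_fin_num Y1.
rewrite -(fineK EYfin); under eq_integral do rewrite muleC.
rewrite integralZl// EX muleC subee// fin_numM ?expectation_fin_num//.
Qed.

Lemma variance_sum (I : eqType) (s : seq I) (X : I -> {mfun T >-> R}) :
  uniq s ->
  (forall i, i \in s -> (X i : T -> R) \in Lfun P 2%:E) ->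
  (forall i j, i \in s -> j \in s -> i != j -> covariance P (X i) (X j) = 0) ->
  'V_P[fun w => (\sum_(i <- s) X i w)%R] = \sum_(i <- s) 'V_P[X i].
Proof.
have sumL2 (s' : seq I) : (forall i, i \in s' -> (X i : T -> R) \in Lfun P 2%:E) ->
    (fun w => (\sum_(i <- s') X i w)%R) \in Lfun P 2%:E.
  elim: s' => [|i s' IH] L2.
    rewrite (_ : (fun w => _) = cst 0%R); first exact: Lfun_cst.
    by apply/funext => w; rewrite big_nil.
  rewrite (_ : (fun w => _) = (X i \+ (fun w => (\sum_(i <- s') X i w)%R))%R).
    rewrite rpredD ?lee1n//= => _; first by apply: L2; rewrite mem_head.
    by apply: IH => j js; apply: L2; rewrite inE js orbT.
  by apply/funext => w; rewrite big_cons.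
have cov_sum i (s' : seq I) : (X i : T -> R) \in Lfun P 2%:E ->
    (forall j, j \in s' -> (X j : T -> R) \in Lfun P 2%:E) ->
    (forall j, j \in s' -> covariance P (X i) (X j) = 0) ->
    covariance P (X i) (fun w => (\sum_(i <- s') X i w)%R) = 0.
  move=> L2i; elim: s' => [|j s' IH] L2 c0.
    rewrite (_ : (fun w => _) = cst 0%R); first exact: covariance_cst_r.
    by apply/funext => w; rewrite big_nil.
  rewrite (_ : (fun w => _) = (X j \+ (fun w => (\sum_(i <- s') X i w)%R))%R); last first.
    by apply/funext => w; rewrite big_cons.
  have L2' k : k \in s' -> (X k : T -> R) \in Lfun P 2%:E.
    by move=> ks; apply: L2; rewrite inE ks orbT.
  rewrite covarianceDr//.
  - rewrite c0 ?mem_head// add0e IH// => k ks.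
    by apply: c0; rewrite inE ks orbT.
  - by apply: L2; rewrite mem_head.
  - exact: sumL2.
elim: s => [|i s IH] /=.
  move=> _ _ _; rewrite big_nil (_ : (fun w => _) = cst 0%R) ?variance_cst//.
  by apply/funext => w; rewrite big_nil.
move=> /andP[is_ us] L2 c0.
rewrite (_ : (fun w => _) = (X i \+ (fun w => (\sum_(i <- s) X i w)%R))%R); last first.
  by apply/funext => w; rewrite big_cons.
have L2i : (X i : T -> R) \in Lfun P 2%:E by apply: L2; rewrite mem_head.
have L2s j : j \in s -> (X j : T -> R) \in Lfun P 2%:E.
  by move=> js; apply: L2; rewrite inE js orbT.
rewrite varianceD//; last exact: sumL2.
rewrite cov_sum//; last first.
  move=> j js; apply: c0; rewrite ?mem_head// ?inE ?js ?orbT//.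
  by apply: contraNneq is_ => ->.
rewrite mule0 adde0 big_cons IH// => j k js ks jk.
by apply: c0 => //; rewrite inE ?js ?ks orbT.
Qed.

End variance_sum.

(** * Products of measures and mixture densities *)

Section tuple_cons.
Context d (T : measurableType d) (n : nat).

Definition tuple_cons (z : T * n.-tuple T) : n.+1.-tuple T :=
  [tuple of z.1 :: z.2].

Lemma measurable_tuple_cons : measurable_fun setT tuple_cons.
Proof. exact: measurable_cons. Qed.

HB.instance Definition _ :=
  isMeasurableFun.Build _ _ _ _ tuple_cons measurable_tuple_cons.

End tuple_cons.

Section cons_measure.
Local Open Scope ereal_scope.
Context d (T : measurableType d) (R : realType) (n : nat).
Variables (nu : {sigma_finite_measure set T -> \bar R})
  (m : {sigma_finite_measure set (n.-tuple T) -> \bar R}).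

Definition cons_measure : set (n.+1.-tuple T) -> \bar R :=
  pushforward (nu \x m) (@tuple_cons d T n).

Let cons_measure0 : cons_measure set0 = 0.
Proof. exact: measure0. Qed.

Let cons_measure_ge0 A : 0 <= cons_measure A.
Proof. exact: measure_ge0. Qed.

Let cons_measure_sigma_additive : semi_sigma_additive cons_measure.
Proof. exact: measure_semi_sigma_additive. Qed.

HB.instance Definition _ := isMeasure.Build _ _ _ cons_measure
  cons_measure0 cons_measure_ge0 cons_measure_sigma_additive.

Lemma cons_measure_sigma_finite : sigma_finite setT cons_measure.
Proof.
have /sigma_finiteP[F [TF ndF Foo]] := sigma_finiteT nu.
have /sigma_finiteP[G [TG ndG Goo]] := sigma_finiteT m.
pose uncons (z : n.+1.-tuple T) := (thead z, [tuple of behead z]).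
exists (fun k => uncons @^-1` (F k `*` G k)).
  apply/seteqP; split => // z _.
  have [k _ Fk] : (\bigcup_k F k) (uncons z).1 by rewrite -TF.
  have [l _ Gl] : (\bigcup_k G k) (uncons z).2 by rewrite -TG.
  exists (maxn k l) => //; split.
  - by move: Fk; exact/subsetPset/ndF/leq_maxl.
  - by move: Gl; exact/subsetPset/ndG/leq_maxr.
move=> k; have [mF Fk] := Foo k; have [mG Gk] := Goo k; split.
  rewrite -[X in measurable X]setTI; apply: measurable_fun_pair => //=.
  - exact: measurable_tnth.
  - exact: measurable_behead.
  - exact: measurableX.
rewrite /cons_measure /pushforward (_ : _ @^-1` _ = F k `*` G k).
  by rewrite product_measure1E// lte_mul_pinfty// ge0_fin_numE.
have consK z : uncons (tuple_cons z) = z.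
  by case: z => x z; rewrite /uncons/= theadE; congr pair; exact/val_inj.
apply: funext => z; rewrite -[LHS]/((F k `*` G k) (uncons (tuple_cons z))) consK.
by [].
Qed.

HB.instance Definition _ := Measure_isSigmaFinite.Build _ _ _ cons_measure
  cons_measure_sigma_finite.

Lemma integral_cons_measure (f : n.+1.-tuple T -> \bar R) :
  measurable_fun setT f -> (forall z, 0 <= f z) ->
  \int[cons_measure]_z f z = \int[nu \x m]_z f (tuple_cons z).
Proof.
by move=> mf f0; rewrite ge0_integral_pushforward.
Qed.

End cons_measure.

(** The integrals of products of functions of one variable are all that
[mixture_density] needs to know of the n-fold product of nu. *)
Lemma power_measure_exists d (T : measurableType d) (R : realType)
    (nu : {sigma_finite_measure set T -> \bar R}) (n : nat) :
  exists m : {sigma_finite_measure set (n.-tuple T) -> \bar R},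
  forall f : 'I_n -> T -> \bar R,
    (forall i, measurable_fun setT (f i)) -> (forall i x, 0 <= f i x)%E ->
    (\int[m]_z (\prod_(i < n) f i (tnth z i)) =
     \prod_(i < n) \int[nu]_x f i x)%E.
Proof.
elim: n => [|n [m IH]].
  exists (\d_ ([tuple] : 0.-tuple T)) => f mf f0.
  rewrite big_ord0; under eq_integral do rewrite big_ord0.
  by rewrite integral_cst//= diracT mule1.
exists (cons_measure nu m) => f mf f0.
have mtnth i : measurable_fun setT (fun z : n.+1.-tuple T => f i (tnth z i)).
  by apply: measurableT_comp => //; exact: measurable_tnth.
rewrite integral_cons_measure//; last 2 first.
- by apply: emeasurable_prod => i _.
- by move=> z; apply: prode_ge0.
have mtail : measurable_fun setT (fun z : n.-tuple T =>
    \prod_(i < n) f (lift ord0 i) (tnth z i))%E.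
  apply: emeasurable_prod => i _.
  by apply: measurableT_comp => //; exact: measurable_tnth.
rewrite fubini_tonelli1/=; last 2 first.
- apply: (@measurableT_comp _ _ _ _ _ _ 
    (fun z : n.+1.-tuple T => (\prod_(i < n.+1) f i (tnth z i))%E)).
    by apply: emeasurable_prod => i _.
  exact: measurable_tuple_cons.
- by move=> z; apply: prode_ge0.
rewrite big_ord_recl; set c := (\prod_(i < n) _)%E.
have c0 : (0 <= c)%E by apply: prode_ge0 => i _; exact: integral_ge0.
rewrite -ge0_integralZr//.
apply: eq_integral => x _; rewrite /fubini_F.
under eq_integral.
  move=> z _; rewrite big_ord_recl tnth0/=.
  under eq_bigr do rewrite tnthS/=.
  over.
rewrite ge0_integralZl//; last by move=> z _; apply: prode_ge0.
by rewrite (IH (fun i => f (lift ord0 i))).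
Qed.

Lemma sigma_tuple_rectangles {d} {T : measurableType d} {n : nat} : measurable = <<s
  [set C : set (n.-tuple T) | exists2 B : 'I_n -> set T,
     forall i, measurable (B i) & C = [set z | forall i, B i (tnth z i)]] >>.
Proof.
apply/seteqP; split => C.
  apply: smallest_sub; first exact: smallest_sigma_algebra.
  move=> D; rewrite -bigcup_seq/= => -[i _ [B mB <-]].
  apply: sub_sigma_algebra; exists (fun j => if j == i then B else setT).
    by move=> j; case: ifP.
  apply/seteqP; split => z /= => [[_ Bz] j|Bz].
    by case: ifPn => // /eqP ->.
  by split => //; have := Bz i; rewrite eqxx.
apply: smallest_sub; first exact: sigma_algebra_measurable.
move=> D [B mB ->].
rewrite (_ : [set z | _] = \bigcap_(i in [set: 'I_n]) ((@tnth n T)^~ i @^-1` B i)).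
  apply: fin_bigcap_measurable; first exact: finite_finset.
  move=> i _; rewrite -[X in measurable X]setTI.
  by apply: measurable_tnth => //.
by apply/seteqP; split => z /= Bz i; [move=> _|]; exact: Bz.
Qed.

Section mixture_density.
Local Open Scope ereal_scope.
Context dV dT (V : measurableType dV) (T : measurableType dT) (R : realType).
Context (n : nat) (mu : probability V R).
Variables (nu : {sigma_finite_measure set T -> \bar R})
  (m : {sigma_finite_measure set (n.-tuple T) -> \bar R}).
Hypothesis mE : forall f : 'I_n -> T -> \bar R,
    (forall i, measurable_fun setT (f i)) -> (forall i x, 0 <= f i x) ->
    \int[m]_z (\prod_(i < n) f i (tnth z i)) = \prod_(i < n) \int[nu]_x f i x.
Variable f : 'I_n -> V -> T -> R.
Hypothesis f0 : forall i v t, (0 <= f i v t)%R.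
Hypothesis mf : forall i, measurable_fun setT (fun vt : V * T => f i vt.1 vt.2).

Definition mixture (z : n.-tuple T) : \bar R :=
  \int[mu]_v (\prod_(i < n) f i v (tnth z i))%:E.

Let F (vz : V * n.-tuple T) : \bar R :=
  (\prod_(i < n) f i vz.1 (tnth vz.2 i))%:E.

Let mF : measurable_fun setT F.
Proof.
apply/measurable_EFinP; apply: measurable_prod => i _.
apply: (@measurableT_comp _ _ _ _ _ _ (fun vt : V * T => f i vt.1 vt.2) _
  (fun vz : V * n.-tuple T => (vz.1, tnth vz.2 i))) => //.
apply: measurable_fun_pair => //.
by apply: (@measurableT_comp _ _ _ _ _ _ (fun z => tnth z i) _ snd) => //; exact: measurable_tnth.
Qed.

Let F0 vz : 0 <= F vz.
Proof. by rewrite lee_fin prodr_ge0. Qed.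

Lemma measurable_mixture : measurable_fun setT mixture.
Proof. exact: (@measurable_fun_fubini_tonelli_G _ _ _ _ _ mu F mF F0). Qed.

Lemma mixture_ge0 z : 0 <= mixture z.
Proof. by apply: integral_ge0 => v _; exact: F0 (v, z). Qed.

(** Both sides are finite measures; on a rectangle, Tonelli turns the left-hand
side into the integral over v of the product of the one-dimensional integrals,
and rectangles form a pi-system. *)
Lemma mixture_density (Q : probability (n.-tuple T) R) :
  (forall B : 'I_n -> set T, (forall i, measurable (B i)) ->
    Q [set z | forall i, B i (tnth z i)] =
    \int[mu]_v \prod_(i < n) \int[nu]_(t in B i) (f i v t)%:E) ->
  forall B, measurable B -> \int[m]_(z in B) mixture z = Q B.
Proof.
move=> QE.
pose D B := \int[m]_(z in B) mixture z.
have D0 : D set0 = 0 by rewrite /D integral_set0.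
have Dge0 A : 0 <= D A by apply: integral_ge0 => z _; exact: mixture_ge0.
have Dadd : semi_sigma_additive D.
  move=> A mA tA mUA; rewrite /D ge0_integral_bigcup//; last 2 first.
  - exact: measurable_funTS measurable_mixture.
  - by move=> z _; exact: mixture_ge0.
  by apply: is_cvg_ereal_nneg_natsum_cond => k _ _; exact: Dge0.
pose Dm : {measure set (n.-tuple T) -> \bar R} :=
  HB.pack D (isMeasure.Build _ _ _ D D0 Dge0 Dadd).
have fB_meas i B v : measurable B -> measurable_fun setT
    (fun t => (f i v t * \1_B t)%:E).
  move=> mB; apply/measurable_EFinP; apply: measurable_funM => //.
  exact: (measurableT_comp (mf i) (pair1_measurable v)).
have rect B : (forall i, measurable (B i)) ->
    D [set z | forall i, B i (tnth z i)] = Q [set z | forall i, B i (tnth z i)].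
  move=> mB; rewrite QE//.
  pose G (vz : V * n.-tuple T) :=
    F vz * (\prod_(i < n) \1_(B i) (tnth vz.2 i))%:E.
  have mG : measurable_fun setT G.
    apply: emeasurable_funM => //; apply/measurable_EFinP.
    apply: measurable_prod => i _.
    apply: (@measurableT_comp _ _ _ _ _ _ (\1_(B i) : T -> R) _
      (fun vz : V * n.-tuple T => tnth vz.2 i)); first exact: measurable_indic.
    apply: (@measurableT_comp _ _ _ _ _ _ (fun z => tnth z i) _ snd) => //.
    exact: measurable_tnth.
  have ind0 z : (0 <= \prod_(i < n) \1_(B i) (tnth z i) :> R)%R.
    by apply: prodr_ge0 => i _; rewrite indicE ler0n.
  have G0 vz : 0 <= G vz by rewrite mule_ge0// lee_fin.
  transitivity (\int[m]_z \int[mu]_v G (v, z)).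
    rewrite /D integral_mkcond; apply: eq_integral => z _.
    rewrite /G/= ge0_integralZr//; last 2 first.
    - exact: (measurableT_comp mF (pair2_measurable z)).
    - by rewrite lee_fin.
    rewrite /patch; case: ifPn => zB.
      rewrite big1 ?mule1// => i _; rewrite indicE mem_set//.
      by move: zB; rewrite inE => /(_ i).
    have [i zi] : exists i, ~ B i (tnth z i).
      by apply/existsNP => zi; move/negP: zB; apply; rewrite inE.
    by rewrite (bigD1 i)//= indicE memNset// mul0r mule0.
  rewrite -(fubini_tonelli G)//; apply: eq_integral => v _.
  rewrite /G/F/=.
  transitivity (\int[m]_z \prod_(i < n) (f i v (tnth z i) * \1_(B i) (tnth z i))%:E).
    by apply: eq_integral => z _; rewrite -EFinM -big_split/= prodEFin.
  rewrite (mE (f := fun i t => (f i v t * \1_(B i) t)%:E)).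
  - apply: eq_bigr => i _; rewrite [RHS]integral_mkcond.
    by apply: eq_integral => t _; rewrite epatch_indic.
  - by move=> i; exact: fB_meas.
  - by move=> i t; rewrite lee_fin mulr_ge0.
have DT : D setT = 1.
  have := rect (fun=> setT) (fun=> measurableT).
  by rewrite (_ : [set z | _] = setT) ?probability_setT//; apply/seteqP; split.
move=> B mB; rewrite -[LHS]/(Dm B).
apply: (measure_unique _ (fun=> setT) sigma_tuple_rectangles) => //.
- move=> _ _ [B1 mB1 ->] [B2 mB2 ->].
  exists (fun i => B1 i `&` B2 i); first by move=> i; exact: measurableI.
  apply/seteqP; split => z /=; first by move=> [? ?] i; split.
  by move=> Bz; split => i; have [] := Bz i.
- move=> _; exists (fun=> setT) => //; by apply/seteqP; split.
- by apply/seteqP; split => // z _; exists 0%N.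
- by move=> A [B' mB' ->]; exact: rect.
- by move=> _; rewrite -[X in X < _]/(D setT) DT ltry.
Qed.

End mixture_density.

(** * Densities of the clusters *)

Section glmm_densities.
Local Open Scope ereal_scope.
Context {R : realType} {dO : measure_display} {p : nat} {phi0 : option R}
  {r N : nat}.
Variable m : glmm dO p phi0 r N.
Local Notation param := 'rV[R]_(glmm_dim p phi0 r).
Variable Theta : set param.
Hypothesis mP : is_glmm m Theta.
Implicit Types (theta : param) (C : {set 'I_N}).

(** The density p_theta(y_C) as a function of the subvector y_C alone, where
marginal_density is a function of the whole vector y. *)
Definition cluster_density C theta : #|C|.-tuple R -> \bar R :=
  mixture (distribution (law m theta) (reff m))
    (fun (k : 'I_#|C|) v t => cond_density theta v (enum_val k) t).

Lemma marginal_densityE C theta y :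
  marginal_density m C theta y = cluster_density theta (subvector C y).
Proof.
apply: eq_integral => v _; congr (_%:E); rewrite big_enum_val/=.
by apply: eq_bigr => k _; rewrite tnth_mktuple.
Qed.

Lemma cond_density_gt0 theta v i t : (0 < cond_density (m := m) theta v i t)%R.
Proof. exact: expR_gt0. Qed.

Lemma measurable_cluster_density C theta : Theta theta ->
  measurable_fun setT (@cluster_density C theta).
Proof.
move=> Th; apply: measurable_mixture => [k v t|k].
  exact/ltW/cond_density_gt0.
exact: (glmm_density_measurable mP).
Qed.

Lemma cluster_density_ge0 C theta z : 0 <= @cluster_density C theta z.
Proof. by apply: mixture_ge0 => k v t; exact/ltW/cond_density_gt0. Qed.

Lemma cluster_density_gt0 C theta z : Theta theta ->
  0 < @cluster_density C theta z.
Proof.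
move=> Th; rewrite lt_neqAle cluster_density_ge0 andbT eq_sym; apply/eqP => d0.
pose P := distribution (law m theta) (reff m).
pose g (v : (nre m).-tuple R) :=
  (\prod_(k < #|C|) cond_density (m := m) theta v (enum_val k) (tnth z k))%R.
have g0 v : (0 < g v)%R by apply: prodr_gt0 => k _; exact: cond_density_gt0.
have mg : measurable_fun setT (EFin \o g).
  apply/measurable_EFinP; apply: measurable_prod => k _.
  exact: (measurableT_comp (glmm_density_measurable mP (enum_val k) Th)
    (pair2_measurable (tnth z k))).
have /(ae_eq_integral_abs P measurableT mg).1 : \int[P]_v `|(EFin \o g) v| = 0.
  rewrite -[RHS]d0; apply: eq_integral => v _.
  by rewrite gee0_abs// lee_fin ltW.
move=> [A [mA PA0 sA]].
have AT : A = setT.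
  apply/seteqP; split => // v _; apply: sA => /= /(_ I) [] gv0.
  by have := g0 v; rewrite gv0 ltxx.
have PA1 : P A = 1 by rewrite AT; exact: probability_setT.
have : (0 : \bar R) < 1 by [].
by rewrite -(etrans (esym PA1) PA0) ltxx.
Qed.

Lemma measurable_subvector C : measurable_fun setT (@subvector R N C).
Proof.
apply/measurable_fun_tnthP => k.
rewrite (_ : _ \o _ = (fun y => tnth y (enum_val k))); first exact: measurable_tnth.
by apply/funext => y /=; rewrite tnth_mktuple.
Qed.

Lemma measurable_subresp C :
  measurable_fun setT (fun w => subvector C (resp m w)).
Proof. exact: (measurableT_comp (@measurable_subvector C) (measurable_funPT (resp m))). Qed.

Definition subresp C : {mfun sample m >-> #|C|.-tuple R} :=
  HB.pack (fun w => subvector C (resp m w))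
    (isMeasurableFun.Build _ _ _ _ _ (@measurable_subresp C)).

(** The reference measure L, a power of nu, is common to all parameters; this is
what allows two parameters to be compared. *)
Lemma cluster_density_exists C :
  exists L : {sigma_finite_measure set (#|C|.-tuple R) -> \bar R},
  forall theta, Theta theta -> forall B, measurable B ->
    \int[L]_(z in B) cluster_density theta z =
    distribution (law m theta) (subresp C) B.
Proof.
have [L LE] := power_measure_exists (nu m) #|C|.
exists L => theta Th B mB.
apply: (mixture_density LE) => //; first by move=> k v t; exact/ltW/cond_density_gt0.
  by move=> k; exact: (glmm_density_measurable mP).
move=> {}B {}mB.
pose B' (i : 'I_N) := \bigcap_(k in [set k : 'I_#|C| | enum_val k = i]) B k.
have mB' i : measurable (B' i).
  by apply: fin_bigcap_measurable => //; exact: finite_finset.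
have B'k k : B' (enum_val k) = B k.
  apply/seteqP; split => [t|t Bt k' /= /enum_val_inj -> //].
  by apply.
have B'N i : i \notin C -> B' i = setT.
  move=> iC; apply/seteqP; split => // t _ k /= ki.
  by move: iC; rewrite -ki enum_valP.
have := glmm_cond_law mP Th measurableT mB'.
rewrite preimage_setT setTI => E.
transitivity (law m theta [set w | forall i, B' i (tnth (resp m w) i)]).
  rewrite /distribution /pushforward; congr (law m theta _).
  apply/seteqP; split => w /= Bw.
    by move=> i k /= <-; have := Bw k; rewrite tnth_mktuple.
  by move=> k; rewrite tnth_mktuple -B'k; exact: Bw.
rewrite E.
pose h (v : (nre m).-tuple R) :=
  \prod_(i < #|C|) \int[nu m]_(t in B i) (cond_density (m := m) theta v (enum_val i) t)%:E.
have h0 v : 0 <= h v.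
  apply: prode_ge0 => i _; apply: integral_ge0 => t _.
  by rewrite lee_fin; exact/ltW/cond_density_gt0.
have mh : measurable_fun setT h.
  apply: emeasurable_prod => i _.
  pose G (vt : (nre m).-tuple R * R) :=
    (cond_density (m := m) theta vt.1 (enum_val i) vt.2 * \1_(B i) vt.2)%:E.
  rewrite (_ : (fun v => _) = fubini_F (nu m) G); last first.
    apply/funext => v; rewrite integral_mkcond; apply: eq_integral => t _.
    by rewrite epatch_indic.
  apply: measurable_fun_fubini_tonelli_F => [|vt]; last first.
    rewrite lee_fin mulr_ge0//; exact/ltW/cond_density_gt0.
  apply/measurable_EFinP; apply: measurable_funM.
    exact: (glmm_density_measurable mP).
  exact: (@measurableT_comp _ _ _ _ _ _ (\1_(B i) : R -> R) _ snd).
rewrite (ge0_integral_distribution _ mh h0).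
apply: eq_integral => w _ /=; rewrite /h.
rewrite (bigID [in C])/= [X in _ * X]big1 ?mule1; last first.
  by move=> i iC; rewrite B'N// (glmm_density_int1 mP).
by rewrite big_enum_val/=; apply: eq_bigr => k _; rewrite B'k.
Qed.

End glmm_densities.

(** * The subset inequality *)

Section subset_inequality.
Local Open Scope ereal_scope.
Context {R : realType} {dO : measure_display} {p : nat} {phi0 : option R}
  {r N : nat}.
Variable m : glmm dO p phi0 r N.
Local Notation param := 'rV[R]_(glmm_dim p phi0 r).
Variable Theta : set param.
Hypothesis mP : is_glmm m Theta.
Implicit Types (theta : param) (C : {set 'I_N}).

(** The value is 0 wherever one of the densities is infinite; this makes
expectation_cluster_ratio hold with no finiteness condition. *)
Definition cluster_ratio C theta theta0 (z : #|C|.-tuple R) : R :=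
  (fine (cluster_density m theta z) /
   fine (cluster_density m theta0 z))%R.

Lemma cluster_ratio_ge0 C theta theta0 (z : #|C|.-tuple R) :
  (0 <= cluster_ratio theta theta0 z)%R.
Proof. by rewrite divr_ge0// fine_ge0// cluster_density_ge0. Qed.

Lemma measurable_cluster_ratio C theta theta0 : Theta theta -> Theta theta0 ->
  measurable_fun setT (@cluster_ratio C theta theta0).
Proof.
move=> Th Th0; apply: measurable_funM.
  by apply: measurableT_comp => //; exact: (measurable_cluster_density mP Th).
rewrite (_ : (fun z => _) =
    (fun z => fine (cluster_density m (C := C) theta0 z) `^ (-1))%R); last first.
  by apply/funext => z; rewrite powR_inv1// fine_ge0// cluster_density_ge0.
apply: (measurableT_comp (measurable_powR _)).
by apply: measurableT_comp => //; exact: (measurable_cluster_density mP Th0).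
Qed.

(** The integral of (p_theta0 / p_theta) * p_theta is at most that of p_theta0,
which is 1. *)
Lemma expectation_cluster_ratio C theta theta0 : Theta theta -> Theta theta0 ->
  \int[law m theta]_w (cluster_ratio theta0 theta (subresp m C w))%:E <= 1.
Proof.
move=> Th Th0; have [L LE] := cluster_density_exists mP C.
have mr := @measurable_cluster_ratio C _ _ Th0 Th.
have mp := @measurable_cluster_density _ _ _ _ _ _ _ _ mP C _ Th.
have mp0 := @measurable_cluster_density _ _ _ _ _ _ _ _ mP C _ Th0.
have r0 (z : #|C|.-tuple R) : 0 <= (cluster_ratio theta0 theta z)%:E :> \bar R.
  by rewrite lee_fin cluster_ratio_ge0.
rewrite -(ge0_integral_distribution (subresp m C)
  (f := fun z => (cluster_ratio theta0 theta z)%:E))//; last first.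
  exact/measurable_EFinP.
rewrite -(@integral_comp_weight _ _ _ _ _ L _ id
  (@cluster_density _ _ _ _ _ _ m C theta))//; last 3 first.
- by move=> z; exact: cluster_density_ge0.
- by move=> B mB; rewrite preimage_id LE.
- exact/measurable_EFinP.
have <- : \int[L]_z cluster_density m theta0 z = 1.
  by rewrite LE// probability_setT.
apply: ge0_le_integral => //.
- by move=> z _; rewrite mule_ge0// cluster_density_ge0.
- by apply: emeasurable_funM => //; exact/measurable_EFinP.
move=> z _; rewrite /cluster_ratio.
have := cluster_density_gt0 mP z Th.
have := cluster_density_ge0 m theta0 z.
case: (cluster_density m theta z) => [s| |]//=; rewrite ?lte_fin => d0.
  case: (cluster_density m theta0 z) d0 => [s0| |]//= d0 s_gt0.
    by rewrite -EFinM divfK// gt_eqF.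
  by rewrite mul0r mul0e.
by rewrite invr0 mulr0 mul0e.
Qed.

(** Integrate the inequality p_theta0 <= e^x p_theta between densities over the
event. *)
Lemma density_ratio_probability theta theta0 x (A : set (N.-tuple R)) :
  Theta theta -> Theta theta0 -> measurable A ->
  law m theta0 [set w | A (resp m w) /\
      marginal_density m [set: 'I_N]%SET theta0 (resp m w) <=
      (expR x)%:E * marginal_density m [set: 'I_N]%SET theta (resp m w)] <=
  (expR x)%:E * law m theta [set w | A (resp m w)].
Proof.
move=> Th Th0 mA; set C := [set: 'I_N]%SET.
have [L LE] := cluster_density_exists mP C.
pose g (z : #|C|.-tuple R) : N.-tuple R :=
  [tuple tnth z (enum_rank_in (finset.in_setT i) i) | i < N].
have mg : measurable_fun setT g.
  apply/measurable_fun_tnthP => i.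
  rewrite (_ : _ \o _ = (fun z => tnth z (enum_rank_in (finset.in_setT i) i))).
    exact: measurable_tnth.
  by apply/funext => z /=; rewrite tnth_mktuple.
have gK y : g (subvector C y) = y.
  apply: eq_from_tnth => i; rewrite !tnth_mktuple enum_rankK_in//.
  exact: finset.in_setT.
have mp := @measurable_cluster_density _ _ _ _ _ _ _ _ mP C _ Th.
have mp0 := @measurable_cluster_density _ _ _ _ _ _ _ _ mP C _ Th0.
pose A' := g @^-1` A.
have mA' : measurable A' by rewrite -[A']setTI; exact: mg.
pose E := A' `&` [set z | cluster_density m theta0 z <=
  (expR x)%:E * cluster_density m theta z].
have mE : measurable E.
  apply: measurableI => //; rewrite -[X in measurable X]setTI.
  by apply: emeasurable_fun_le => //; exact: emeasurable_funM.
have -> : [set w | A (resp m w) /\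
      marginal_density m C theta0 (resp m w) <=
      (expR x)%:E * marginal_density m C theta (resp m w)] = subresp m C @^-1` E.
  by apply/seteqP; split => w /=; rewrite /E/A'/= gK !marginal_densityE.
have -> : [set w | A (resp m w)] = subresp m C @^-1` A'.
  by apply/seteqP; split => w /=; rewrite /A'/= gK.
rewrite -[leLHS]/(distribution (law m theta0) (subresp m C) E) -LE//.
rewrite -[law m theta _]/(distribution (law m theta) (subresp m C) A') -LE//.
rewrite -ge0_integralZl//; last 2 first.
- exact: measurable_funTS.
- by move=> z _; exact: cluster_density_ge0.
have mpx : measurable_fun setT (fun z => (expR x)%:E * cluster_density m (C := C) theta z).
  exact: emeasurable_funM.
apply: (@le_trans _ _ (\int[L]_(z in E) ((expR x)%:E * cluster_density m theta z))).
  apply: ge0_le_integral => //.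
  - by move=> z _; exact: cluster_density_ge0.
  - exact: measurable_funTS.
  - exact: measurable_funTS.
  - by move=> z [].
apply: ge0_subset_integral => //.
- exact: measurable_funTS.
- by move=> z _; rewrite mule_ge0 ?lee_fin ?expR_ge0// cluster_density_ge0.
- by move=> z [].
Qed.

Lemma independent_clusters_comp (S : {set {set 'I_N}}) theta
    (g : forall C : {set 'I_N}, #|C|.-tuple R -> R)
    (Z : {set 'I_N} -> {mfun sample m >-> R}) :
  independent_clusters m S theta ->
  (forall C, measurable_fun setT (g C)) ->
  (forall C w, Z C w = g C (subvector C (resp m w))) ->
  forall B : {set 'I_N} -> set R, (forall C, measurable (B C)) ->
  law m theta [set w | forall C, C \in S -> B C (Z C w)] =
  \prod_(C in S) law m theta (Z C @^-1` B C).
Proof.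
move=> indep mg ZE B mB.
have mgB C : measurable (g C @^-1` B C).
  by rewrite -[X in measurable X]setTI; exact: mg.
have := indep _ mgB => /=; under eq_bigr => C _.
  rewrite (_ : [set w | _] = Z C @^-1` B C); last first.
    by apply/seteqP; split => w /=; rewrite ZE.
  over.
move=> <-; congr (law m theta _).
by apply/seteqP; split => w /= BZ C CS; have := BZ C CS; rewrite ZE.
Qed.

(** The event on the cluster ratios has probability at most e^(-c) under theta,
by Markov, because the clusters are independent under theta. *)
Lemma subset_inequality (S : {set {set 'I_N}}) theta theta0 (x c : R) :
  Theta theta -> Theta theta0 -> independent_clusters m S theta ->
  law m theta0 [set w | (expR c <= \prod_(C in S)
        cluster_ratio theta0 theta (subvector C (resp m w)))%R /\
      marginal_density m [set: 'I_N]%SET theta0 (resp m w) <=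
      (expR x)%:E * marginal_density m [set: 'I_N]%SET theta (resp m w)] <=
  (expR (x - c))%:E.
Proof.
move=> Th Th0 indep.
pose h (y : N.-tuple R) :=
  (\prod_(C in S) cluster_ratio theta0 theta (subvector C y))%R.
have mh : measurable_fun setT h.
  rewrite /h; under eq_fun do rewrite -big_enum/=.
  apply: measurable_prod => C _.
  exact: (measurableT_comp (@measurable_cluster_ratio C _ _ Th0 Th)
    (@measurable_subvector R N C)).
have h0 y : (0 <= h y)%R by apply: prodr_ge0 => C _; exact: cluster_ratio_ge0.
pose A := [set y | (expR c <= h y)%R].
have mA : measurable A.
  rewrite -[A]setTI (_ : A = h @^-1` `[expR c, +oo[%classic).
    exact: mh.
  by apply/seteqP; split => y /=; rewrite in_itv/= andbT.
apply: (le_trans (density_ratio_probability x Th Th0 mA)).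
rewrite expRD EFinM lee_pmul2l ?lte_fin ?expR_gt0//.
pose mZ C := measurableT_comp (@measurable_cluster_ratio C _ _ Th0 Th)
  (@measurable_subresp _ _ _ _ _ _ m C).
pose Z C : {mfun sample m >-> R} :=
  HB.pack (fun w => cluster_ratio theta0 theta (subvector C (resp m w)))
    (isMeasurableFun.Build _ _ _ _ _ (mZ C)).
have EZ C : \int[law m theta]_w (Z C w)%:E <= 1.
  exact: expectation_cluster_ratio.
have Eprod : \int[law m theta]_w (h (resp m w))%:E <= 1.
  have indepZ := independent_clusters_comp (Z := Z) indep
    (fun C => measurable_cluster_ratio Th0 Th) (fun C w => erefl).
  have absZ C w : `|Z C w|%:E = (Z C w)%:E :> \bar R.
    by rewrite ger0_norm// cluster_ratio_ge0.
  have EabsZ C : \int[law m theta]_w `|Z C w|%:E <= 1.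
    by under eq_integral do rewrite absZ; exact: EZ.
  have := integral_prod_indep indepZ (h := fun _ x => `|x|%:E).
  under eq_integral.
    move=> w _; under eq_bigr do rewrite absZ.
    rewrite prodEFin; over.
  move=> ->.
  - suff /andP[] : 0 <= \prod_(C in S) \int[law m theta]_w `|Z C w|%:E <= 1 by [].
      apply: (big_ind (fun x : \bar R => 0 <= x <= 1)) => [|a b /andP[a0 a1] /andP[b0 b1]|C _].
      - by rewrite lexx lee01.
      - by rewrite mule_ge0//= -[leRHS]mule1 lee_pmul.
      - by rewrite EabsZ andbT; apply: integral_ge0 => w _; rewrite lee_fin.
  - by move=> C; apply/measurable_EFinP; exact: normr_measurable.
  - by move=> C z; rewrite lee_fin.
  - by move=> C _; rewrite (le_lt_trans (EabsZ C))// ltry.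
have mAw : measurable [set w | A (resp m w)].
  exact: (measurable_funPTI (resp m) mA).
have cA : (expR c)%:E * law m theta [set w | A (resp m w)] <= 1.
  apply: le_trans Eprod; rewrite -(integral_indicT _ mAw) -ge0_integralZl//; last first.
    exact/measurable_EFinP/measurable_indic.
  apply: ge0_le_integral => //.
  - by apply: emeasurable_funM => //; exact/measurable_EFinP/measurable_indic.
  - apply/measurable_EFinP; apply: (measurableT_comp mh).
    exact: (measurable_funPT (resp m)).
  - move=> w _; rewrite -EFinM lee_fin indicE.
    by case: (boolP (w \in _)) => [|_]; [rewrite inE mulr1|rewrite mulr0].
move: cA; rewrite -lee_pdivlMl ?expR_gt0// mule1 expRN.
by [].
Qed.

Lemma measurable_subset_event (S : {set {set 'I_N}}) theta theta0 (x c : R) :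
  Theta theta -> Theta theta0 ->
  measurable [set w | (expR c <= \prod_(C in S)
        cluster_ratio theta0 theta (subvector C (resp m w)))%R /\
      marginal_density m [set: 'I_N]%SET theta0 (resp m w) <=
      (expR x)%:E * marginal_density m [set: 'I_N]%SET theta (resp m w)].
Proof.
move=> Th Th0.
have mh : measurable_fun setT (fun w => \prod_(C in S)
    cluster_ratio theta0 theta (subvector C (resp m w)))%R.
  under eq_fun do rewrite -big_enum/=.
  apply: measurable_prod => C _.
  exact: (measurableT_comp (@measurable_cluster_ratio C _ _ Th0 Th)
    (measurable_funPT (subresp m C))).
have md t : Theta t -> measurable_fun setT
    (fun w => marginal_density m [set: 'I_N]%SET t (resp m w)).
  move=> Tt; under eq_fun do rewrite marginal_densityE.
  exact: (measurableT_comp (measurable_cluster_density mP Tt)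
    (measurable_funPT (subresp m [set: 'I_N]%SET))).
apply: (measurableI [set w | (expR c <= \prod_(C in S)
  cluster_ratio theta0 theta (subvector C (resp m w)))%R]).
  rewrite -[X in measurable X]setTI (_ : [set w | _] =
    (fun w => \prod_(C in S) cluster_ratio theta0 theta (subvector C (resp m w)))%R
      @^-1` `[expR c, +oo[%classic); first exact: mh.
  by apply/seteqP; split => w /=; rewrite in_itv/= andbT.
rewrite -[X in measurable X]setTI; apply: emeasurable_fun_le => //.
  exact: md.
by apply: emeasurable_funM => //; exact: md.
Qed.

End subset_inequality.

(** * Sums of cluster log-likelihood ratios *)

Section cluster_sums.
Local Open Scope ereal_scope.
Context {R : realType} {dO : measure_display} {p : nat} {phi0 : option R}
  {r N : nat}.
Variable m : glmm dO p phi0 r N.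
Local Notation param := 'rV[R]_(glmm_dim p phi0 r).
Variable Theta : set param.
Hypothesis mP : is_glmm m Theta.
Variables (theta theta0 : param) (S : {set {set 'I_N}}).
Hypotheses (Th : Theta theta) (Th0 : Theta theta0).
Hypothesis indep : independent_clusters m S theta0.
Let P := law m theta0.

Let lr C w := log_ratio m C theta theta0 (resp m w).

Lemma log_ratioE C y :
  log_ratio m C theta theta0 y = ln (cluster_ratio m theta theta0 (subvector C y)).
Proof. by rewrite /log_ratio /cluster_ratio !marginal_densityE. Qed.

Let mln (C : {set 'I_N}) : measurable_fun setT
  (fun z : #|C|.-tuple R => ln (cluster_ratio m theta theta0 z)).
Proof. exact: (measurableT_comp (@measurable_ln R) (measurable_cluster_ratio mP Th Th0)). Qed.

Let mlr (C : {set 'I_N}) : measurable_fun setT (lr C).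
Proof.
rewrite (_ : lr C = (fun z => ln (cluster_ratio m theta theta0 z)) \o subresp m C).
  exact: (measurableT_comp (@mln C) (measurable_funPT (subresp m C))).
by apply/funext => w; rewrite /lr log_ratioE.
Qed.

Let Z C : {mfun sample m >-> R} := HB.pack (lr C)
  (isMeasurableFun.Build _ _ _ _ _ (@mlr C)).

Lemma measurable_sum_log_ratio :
  measurable_fun setT (fun w => (\sum_(C in S) lr C w)%R).
Proof.
under eq_fun do rewrite -big_enum/=.
by apply: measurable_sum => C; exact: mlr.
Qed.

Hypothesis Voo : forall C, C \in S -> 'V_P[lr C] < +oo.

Let L2 C : C \in S -> (Z C : _ -> R) \in Lfun P 2%:E.
Proof. by move=> CS; apply: (@Lfun2_variance _ _ _ P (Z C)); exact: Voo. Qed.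

Let L1 C : C \in S -> (Z C : _ -> R) \in Lfun P 1.
Proof. by move=> /L2; apply: Lfun_subset12; exact: fin_num_measure. Qed.

Lemma cluster_expectation_fin_num C : C \in S -> 'E_P[lr C] \is a fin_num.
Proof. by move=> /L1; exact: expectation_fin_num. Qed.

(** Finite variances make the log-ratios square integrable, and those of distinct
clusters are uncorrelated by independence. *)
Lemma clusters_chebyshev (e : R) : (0 < e)%R ->
  P [set w | (e <= `|\sum_(C in S) lr C w - \sum_(C in S) fine 'E_P[lr C]|)%R]
  <= (e ^- 2)%:E * \sum_(C in S) 'V_P[lr C].
Proof.
move=> e0.
have indepZ := independent_clusters_comp (Z := Z) indep (fun C => @mln C)
  (fun C w => log_ratioE C (resp m w)).
pose Y w := (\sum_(C <- enum S) Z C w)%R.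
have mY : measurable_fun setT Y by apply: measurable_sum.
pose Yf : {mfun sample m >-> R} := HB.pack Y (isMeasurableFun.Build _ _ _ _ _ mY).
have VY : 'V_P[Y] = \sum_(C in S) 'V_P[lr C].
  rewrite -big_enum/=; apply: (variance_sum (X := Z)).
  - exact: enum_uniq.
  - by move=> C; rewrite mem_enum; exact: L2.
  move=> C C'; rewrite !mem_enum => CS C'S CC'.
  apply: covariance_indep; [exact: L2|exact: L2|] => A B mA mB.
  exact: (pairwise_indep indepZ).
have EY : fine 'E_P[Y] = (\sum_(C in S) fine 'E_P[lr C])%R.
  rewrite -big_enum/=; rewrite /Y.
  have : {subset enum S <= S} by move=> C; rewrite mem_enum.
  elim: (enum S) => [|C s IH] sS.
    rewrite big_nil (_ : (fun w => _) = cst 0%R) ?expectation_cst//.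
    by apply/funext => w; rewrite big_nil.
  rewrite (_ : (fun w => _) = (Z C \+ (fun w => (\sum_(C <- s) Z C w)%R))%R); last first.
    by apply/funext => w; rewrite big_cons.
  have sS' : {subset s <= S} by move=> C' C's; apply: sS; rewrite inE C's orbT.
  have L1s : (fun w => (\sum_(C <- s) Z C w)%R) \in Lfun P 1.
    elim: s {IH sS} sS' => [|C' s IH] sS.
      rewrite (_ : (fun w => _) = cst 0%R); first exact: Lfun_cst.
      by apply/funext => w; rewrite big_nil.
    rewrite (_ : (fun w => _) = (Z C' \+ (fun w => (\sum_(C <- s) Z C w)%R))%R).
      rewrite rpredD//=; first by apply/L1/sS; rewrite mem_head.
      by apply: IH => D Ds; apply: sS; rewrite inE Ds orbT.
    by apply/funext => w; rewrite big_cons.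
  have L1C : (Z C : _ -> R) \in Lfun P 1 by apply/L1/sS; rewrite mem_head.
  rewrite expectationD// fineD ?expectation_fin_num// big_cons IH//.
have := @chebyshev _ _ _ P Yf e e0.
rewrite VY EY [X in P X <= _ -> _](_ : _ = [set w |
  (e <= `|\sum_(C in S) lr C w - \sum_(C in S) fine 'E_P[lr C]|)%R])//.
by apply/seteqP; split => w /=; rewrite /Y big_enum.
Qed.

End cluster_sums.

(** * Functions with bounded partial derivatives on a cube *)

Section row_norm.
Context {R : realType} {d : nat}.
Implicit Types x y : 'rV[R]_d.

Lemma row_norm_leP x (e : R) : 0 <= e ->
  reflect (forall c, `|x 0 c| <= e) (`|x| <= e).
Proof.
move=> e0; rewrite [`|x|]mx_normrE.
apply: (iffP (bigmax_leP _ _ _ _)) => [[_ xe] c|xe]; first exact: (xe (0, c)).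
by split => // -[i c] _ /=; rewrite ord1.
Qed.

Lemma coord_le_norm x c : `|x 0 c| <= `|x|.
Proof. by move/row_norm_leP : (lexx `|x|) => /(_ (normr_ge0 _)). Qed.

Lemma row_norm_attained x : (0 < d)%N -> exists c, `|x 0 c| = `|x|.
Proof.
move=> d0; have [x0|/mx_norm_neq0[[i c] xE]] := eqVneq (mx_norm x) 0.
  exists (Ordinal d0); rewrite (mx_norm_eq0 x0) mxE normr0.
  by rewrite -[RHS]/(mx_norm (0 : 'rV[R]_d)) mx_norm0.
by exists c; rewrite -[RHS]/(mx_norm x) xE /= ord1.
Qed.

Lemma norm_le_enorm x : `|x| <= enorm x.
Proof.
apply/row_norm_leP => [|c]; first exact: sqrtr_ge0.
rewrite -sqrtr_sqr ler_sqrt; last by apply: sumr_ge0 => i _; exact: sqr_ge0.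
rewrite (bigD1 c)//= lerDl; apply: sumr_ge0 => i _; exact: sqr_ge0.
Qed.

Lemma enorm_le_norm x : enorm x <= d%:R * `|x|.
Proof.
have [d0|d0] := posnP d.
  rewrite /enorm big1 ?sqrtr0 ?mulr_ge0// => c _.
  by have := leq_ltn_trans (leq0n c) (ltn_ord c); rewrite [X in (_ < X)%N]d0.
rewrite -[leRHS]ger0_norm ?mulr_ge0// -sqrtr_sqr ler_sqrt ?sqr_ge0//.
apply: (@le_trans _ _ (d%:R * `|x| ^+ 2)).
  rewrite mulr_natl -[X in _ *+ X]card_ord -sumr_const ler_sum// => c _.
  by rewrite -real_normK ?num_real// ler_sqr ?nnegrE// coord_le_norm.
rewrite exprMn ler_wpM2r ?sqr_ge0// expr2 ler_peMl ?ler0n// ler1n//.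
Qed.

End row_norm.

Section partials.
Context {R : realType} {d : nat}.
Implicit Types (A : set 'rV[R]_d) (F : 'rV[R]_d -> R) (x : 'rV[R]_d).

Lemma interior_direction A x c : A° x ->
  \forall h \near (0 : R), A (x + h *: unitv c).
Proof.
move=> Ax; have : (fun h : R => x + h *: unitv c) @ 0 --> x.
  have := cvgD (cvg_cst x) (@scalel_continuous _ _ (unitv c : 'rV[R]_d) (0 : R)).
  by rewrite scale0r addr0; apply.
by apply; exact: Ax.
Qed.

Lemma interior_admissible A x c : A° x -> admissible A x c.
Proof.
move=> /(interior_direction c) /nbhs_ballP[e /= e0 eA].
exists (e / 2); split; first by rewrite gt_eqF ?divr_gt0.
apply: eA; rewrite /ball/= sub0r normrN gtr0_norm ?divr_gt0//.
by rewrite gtr_pMr// invf_lt1// ltr1n.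
Qed.

(** Inside A the constraint on the increments is void near 0. *)
Lemma interior_partial_nbhs A x c : A° x -> partial_nbhs A x c = 0^'.
Proof.
move=> /(interior_direction c) Ax; apply/seteqP; split => B.
  rewrite /partial_nbhs /within/= => AB.
  have Ax' : (0 : R)^' [set h | A (x + h *: unitv c)] by exact: nbhs_dnbhs.
  by apply: (filterS2 _ _ Ax' AB) => h Ah AhB; exact: AhB Ah.
by apply: filterS => h Bh _.
Qed.

Lemma interior_derivable A F x c : A° x -> has_partial A F x c ->
  is_derive x (unitv c) F (partial A F x c).
Proof.
move=> Ax; rewrite /has_partial /partial interior_partial_nbhs//.
have -> : partial_quotient F x c =
    (fun h => h^-1 *: ((F \o shift x) (h *: unitv c) - F x)).
  by apply/funext => h; rewrite /partial_quotient /= [x + _]addrC.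
by move=> cF; exact: DeriveDef.
Qed.

Lemma partial_le_max A F x c : A° x -> `|partial A F x c| <= max_partial A F x.
Proof.
move=> Ax; rewrite /max_partial; apply: le_bigmax_cond.
by apply/asboolP; exact: interior_admissible.
Qed.

(** Reduces partial derivatives to derivatives of functions of one real
variable. *)
Lemma is_derive_line F x c (h df : R) :
  is_derive (x + h *: unitv c) (unitv c) F df <->
  is_derive h (1 : R) (fun t => F (x + t *: unitv c)) df.
Proof.
have E : (fun k : R => k^-1 *: ((F \o shift (x + h *: unitv c)) (k *: unitv c)
    - F (x + h *: unitv c))) =
  (fun k : R => k^-1 *: (((fun t => F (x + t *: unitv c)) \o shift h) (k *: (1 : R))
    - F (x + h *: unitv c))).
  apply/funext => k /=; congr (_ *: (F _ - _)).
  by rewrite [k%:A]mulr1 scalerDl addrCA.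
split => -[dF DF]; split.
- by move: dF; rewrite /derivable E.
- by move: DF; rewrite /derive E.
- by move: dF; rewrite /derivable E.
- by move: DF; rewrite /derive E.
Qed.

End partials.

Section cube.
Context {R : realType} {d : nat}.
Variables (F : 'rV[R]_d -> R) (dF : 'rV[R]_d -> 'I_d -> R).
Variables (x0 : 'rV[R]_d) (rho L : R).
Hypothesis rho0 : 0 <= rho.
Hypothesis dFP : forall x c, `|x - x0| <= rho ->
  is_derive x (unitv c) F (dF x c).
Hypothesis dFL : forall x c, `|x - x0| <= rho -> `|dF x c| <= L.

Lemma cube_line x c (t h : R) : `|x - x0| <= rho ->
  `|x + t *: unitv c - x0| <= rho -> h \in `[Num.min 0 t, Num.max 0 t] ->
  `|x + h *: unitv c - x0| <= rho.
Proof.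
move=> /(row_norm_leP _ rho0) xr /(row_norm_leP _ rho0) xtr.
rewrite in_itv/= => /andP[h1 h2]; apply/row_norm_leP => // j.
move: (xr j) (xtr j); rewrite !mxE/=; case: eqVneq => /= [_|_]; last first.
  by rewrite !mulr0 !addr0.
rewrite !mulr1 !ler_norml => /andP[a1 a2] /andP[b1 b2].
move: h1 h2; rewrite ge_min le_max.
by move=> /orP[h1|h1] /orP[h2|h2]; apply/andP; split; lra.
Qed.

(** Mean value inequality on a segment parallel to an axis. *)
Lemma lipschitz_line x c (t : R) : `|x - x0| <= rho ->
  `|x + t *: unitv c - x0| <= rho -> `|F (x + t *: unitv c) - F x| <= L * `|t|.
Proof.
move=> xr xtr; pose g h := F (x + h *: unitv c).
pose dg h := dF (x + h *: unitv c) c.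
have gd h : h \in `[Num.min 0 t, Num.max 0 t] -> is_derive h 1 g (dg h).
  move=> ht; apply/is_derive_line; exact: dFP (cube_line xr xtr ht).
have gL a b : a <= b -> (forall h, h \in `[a, b] -> h \in `[Num.min 0 t, Num.max 0 t]) ->
    `|g b - g a| <= L * `|b - a|.
  move=> ab sub; have gd' h : h \in `[a, b] -> is_derive h 1 g (dg h).
    by move=> /sub /gd.
  have cg : {within `[a, b], continuous g}.
    apply: derivable_within_continuous => h /gd' gdh.
    exact: (@ex_derive _ _ _ _ _ _ _ gdh).
  have gd'' h : h \in `]a, b[ -> is_derive h 1 g (dg h).
    by move=> hin; apply: gd'; exact: subset_itv_oo_cc.
  have [h hin gE] := MVT_segment ab gd'' cg.
  rewrite gE normrM ler_wpM2r//.
  exact: dFL (cube_line xr xtr (sub _ hin)).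
have g0 : g 0 = F x by rewrite /g scale0r addr0.
rewrite -g0 -[F _]/(g t).
have [t0|t0] := leP 0 t.
  rewrite -[X in _ * `|X|]subr0; apply: gL => // h.
  by rewrite (min_idPl t0) (max_idPr t0).
have <- : `|0 - t| = `|t| by rewrite sub0r normrN.
rewrite distrC; apply: gL => [|h]; first exact: ltW.
by rewrite (min_idPr (ltW t0)) (max_idPl (ltW t0)).
Qed.

(** Only partial derivatives are available: go from x to y by changing one
coordinate at a time, which does not leave the cube. *)
Lemma lipschitz_cube x y : `|x - x0| <= rho -> `|y - x0| <= rho ->
  `|F x - F y| <= L * d%:R * `|x - y|.
Proof.
move=> xr yr.
(* the first k coordinates of y, followed by the remaining ones of x *)
pose z (k : nat) : 'rV[R]_d := \row_j (if (j < k)%N then y 0 j else x 0 j).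
have zr k : `|z k - x0| <= rho.
  apply/row_norm_leP => // j; rewrite !mxE.
  move: (elimT (row_norm_leP _ rho0) xr j) (elimT (row_norm_leP _ rho0) yr j).
  by rewrite !mxE; case: ifP.
have step (k : 'I_d) : `|F (z k) - F (z k.+1)| <= L * `|x - y|.
  have zE : z k.+1 = z k + (y 0 k - x 0 k) *: unitv k.
    apply/rowP => j; rewrite !mxE/= ltnS.
    case: (ltngtP j k) => [jk|kj|jk]; last first.
    - have -> : j = k by exact/val_inj.
      by rewrite eqxx mulr1 addrC subrK.
    - by rewrite [j == k]eq_sym -val_eqE/= (ltn_eqF kj) mulr0 addr0.
    - by rewrite -val_eqE/= (ltn_eqF jk) mulr0 addr0.
  have zr1 := zr k.+1; rewrite zE in zr1 *; rewrite distrC.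
  apply: (le_trans (lipschitz_line (zr k) zr1)).
  have L0 : 0 <= L.
    exact: le_trans (dFL k xr).
  rewrite ler_wpM2l// distrC.
  by have := coord_le_norm (x - y) k; rewrite !mxE.
have zx : z 0%N = x by apply/rowP => j; rewrite mxE.
have zy : z d = y by apply/rowP => j; rewrite mxE ltn_ord.
have tele n : (n <= d)%N -> `|F x - F (z n)| <= L * n%:R * `|x - y|.
  elim: n => [|n IH] nd; first by rewrite zx subrr normr0 mulr0 mul0r.
  rewrite -(subrKA (F (z n))) (le_trans (ler_normD _ _))//.
  rewrite -addn1 natrD mulrDr mulrDl mulr1 lerD ?IH ?(ltnW nd)//.
  by rewrite addn1; exact: (step (Ordinal nd)).
by rewrite -[in leLHS]zy; exact: tele.
Qed.

(** The Lipschitz bound makes F continuous, so that F has a maximum on the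
compact cube; the hypothesis on the boundary puts it in the interior. *)
Lemma cube_critical_point : (0 < d)%N ->
  (forall x, `|x - x0| = rho -> F x < F x0) ->
  exists2 x, `|x - x0| <= rho & forall c, is_derive x (unitv c) F 0.
Proof.
move=> d0 bd; pose c0 := Ordinal d0; pose K := [set x | `|x - x0| <= rho].
have cF : {within K, continuous F}.
  apply/subspace_continuousP => x Kx; apply/cvgrPdist_lt => e e0.
  have L0 : 0 <= L.
    exact: le_trans (dFL c0 Kx).
  have Ld : 0 < L * d%:R + 1 by rewrite ltr_wpDl// mulr_ge0.
  apply/nbhs_ballP; exists (e / (L * d%:R + 1)); first by rewrite /= divr_gt0.
  move=> t; rewrite -ball_normE/= ltr_pdivlMr// => xt Kt.
  apply: le_lt_trans (lipschitz_cube Kx Kt) _; apply: le_lt_trans xt.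
  by rewrite mulrC ler_wpM2l// lerDl.
have Kc : compact K.
  apply: bounded_closed_compact.
    exists (`|x0| + rho); split; first exact: num_real.
    move=> M rM x Kx; apply: le_trans (ltW rM).
    by rewrite -[x](subrK x0) addrC (le_trans (ler_normD _ _))// lerD2l.
  rewrite (_ : K = (fun x : 'rV[R]_d => `|x - x0|) @^-1` [set t | t <= rho])//.
  apply: closed_comp; last exact: closed_le.
  move=> x _; apply: continuous_comp; last exact: norm_continuous.
  exact: (cvgB cvg_id (cvg_cst _)).
have K0 : K !=set0 by exists x0; rewrite /K/= subrr normr0.
have [x] := EVT_max_rV K0 Kc cF.
rewrite inE => Kx xmax; exists x => // c.
have xlt : `|x - x0| < rho.
  rewrite lt_neqAle; apply/andP; split => //; apply/eqP => /bd.
  by rewrite ltNge xmax// inE /K/= subrr normr0.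
pose e := rho - `|x - x0|.
have e0 : 0 < e by rewrite subr_gt0.
have xh h : h \in `]-e, e[ -> `|x + h *: unitv c - x0| <= rho.
  rewrite in_itv/= -ltr_norml => he.
  rewrite addrAC (le_trans (ler_normD _ _))// -lerBrDl.
  rewrite -/e (le_trans _ (ltW he))//; apply/row_norm_leP => // j.
  by rewrite !mxE eqxx/= normrM; case: (j == c); rewrite ?normr1 ?normr0 ?mulr1 ?mulr0.
have : is_derive 0 (1 : R) (fun t => F (x + t *: unitv c)) 0.
  apply: (@derive1_at_max _ _ (- e) e); first by rewrite ge0_cp// ltW.
  - move=> t te; have xt := xh t te.
    have /is_derive_line gt := dFP c xt.
    exact: (@ex_derive _ _ _ _ _ _ _ gt).
  - by rewrite in_itv/= oppr_lt0 e0.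
  - move=> t te; rewrite scale0r addr0; apply: xmax; rewrite inE; exact: xh.
by move/is_derive_line; rewrite scale0r addr0.
Qed.

End cube.

(** * Nets on the boundary of a cube *)

Section sphere_grid.
Context {R : realType} {d k : nat}.
Variables (x0 : 'rV[R]_d.+1) (rho : R).
Hypothesis rho_gt0 : 0 < rho.

(** A face of the cube, given by a coordinate and a sign, together with a point
of a regular (d-dimensional) grid of that face. *)
Definition grid_index : finType := ('I_d.+1 * bool * {ffun 'I_d -> 'I_k.+1})%type.

Definition grid_offset (a : grid_index) : 'rV[R]_d.+1 :=
  \row_j if unlift a.1.1 j is Some l
         then - rho + 2 * rho * ((a.2 l)%:R / k.+1%:R)
         else (-1) ^+ a.1.2 * rho.

Definition grid_point (a : grid_index) : 'rV[R]_d.+1 := x0 + grid_offset a.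

Lemma card_grid_index : #|grid_index| = (d.+1 * 2 * k.+1 ^ d)%N.
Proof. by rewrite !card_prod card_ffun !card_ord card_bool. Qed.

Lemma grid_point_norm a : `|grid_point a - x0| = rho.
Proof.
have -> : grid_point a - x0 = grid_offset a by rewrite /grid_point addrAC subrr add0r.
apply/eqP; rewrite eq_le; apply/andP; split.
  apply/row_norm_leP => [|j]; first exact: ltW.
  rewrite mxE; case: unliftP => [l _|_]; last first.
    by rewrite normrM normrX normrN1 expr1n mul1r gtr0_norm.
  have q1 : (a.2 l)%:R / k.+1%:R <= 1 :> R.
    by rewrite ler_pdivrMr ?ltr0n// mul1r ler_nat ltnW.
  have q0 : 0 <= (a.2 l)%:R / k.+1%:R :> R by rewrite divr_ge0.
  move: q0 q1; set q := _ / _ => q0 q1.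
  have q0' : 0 <= rho * q by rewrite mulr_ge0// ltW.
  have q1' : rho * q <= rho by rewrite ler_piMr// ltW.
  by rewrite ler_norml -mulrA; apply/andP; split; lra.
apply: le_trans (coord_le_norm _ a.1.1); rewrite mxE unlift_none.
by rewrite normrM normrX normrN1 expr1n mul1r gtr0_norm.
Qed.

Lemma grid_point_near (x : 'rV[R]_d.+1) : `|x - x0| = rho ->
  exists a, `|x - grid_point a| <= 2 * rho / k.+1%:R.
Proof.
move=> xr; have [c xc] := row_norm_attained (x - x0) isT.
have K0 : 0 < k.+1%:R :> R by rewrite ltr0n.
have err0 : 0 <= 2 * rho / k.+1%:R by rewrite divr_ge0 ?ltW ?mulr_gt0.
pose u (j : 'I_d.+1) : R := ((x - x0) 0 j + rho) / (2 * rho) * k.+1%:R.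
have ub j : - rho <= (x - x0) 0 j <= rho.
  by rewrite -ler_norml -xr coord_le_norm.
have u0 j : 0 <= u j.
  apply: mulr_ge0; last exact: ltW.
  apply: divr_ge0; last by rewrite ltW ?mulr_gt0.
  by have /andP[] := ub j; rewrite -lerBlDr sub0r.
(* the bound k matters on the edge of the face where u j = k + 1 *)
pose i (j : 'I_d.+1) : 'I_k.+1 := inord (minn (Num.truncn (u j)) k).
have iE j : i j = minn (Num.truncn (u j)) k :> nat.
  by rewrite inordK// ltnS geq_minr.
pose a : grid_index := ((c, (x - x0) 0 c < 0), [ffun l => i (lift c l)]).
exists a; apply/row_norm_leP => // j.
have -> : (x - grid_point a) 0 j = (x - x0) 0 j - grid_offset a 0 j.
  by rewrite /grid_point opprD addrA [LHS]mxE; congr (_ + _); rewrite mxE.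
rewrite [grid_offset _ _ _]mxE /=.
case: unliftP => [l jl|->]; last first.
  rewrite [X in X <= _](_ : _ = 0)//.
  apply/eqP; rewrite normr_eq0 subr_eq0; apply/eqP.
  move: xc; rewrite xr => xc.
  have [y0|y0] := ltP ((x - x0) 0 c) 0; rewrite /=.
    by move: xc; rewrite ltr0_norm// => <-; rewrite expr1 mulN1r opprK.
  by rewrite expr0 mul1r -xc ger0_norm.
rewrite ffunE -jl iE.
have /andP[t1 t2] := truncn_itv (u0 j).
have uk : u j <= k.+1%:R.
  rewrite /u; apply: ler_piMl; first exact: ltW.
  rewrite ler_pdivrMr ?mulr_gt0// mul1r.
  by have /andP[_ ubj] := ub j; lra.
have E : (x - x0) 0 j = - rho + 2 * rho * (u j / k.+1%:R).
  rewrite /u mulfK ?gt_eqF// mulrC divfK; first by rewrite [RHS]addrC addrK.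
  by rewrite gt_eqF ?mulr_gt0.
rewrite E; set n := minn _ _.
have -> : - rho + 2 * rho * (u j / k.+1%:R) -
    (- rho + 2 * rho * (n%:R / k.+1%:R)) =
    2 * rho / k.+1%:R * (u j - n%:R).
  by move: (k.+1%:R^-1) => K; ring.
rewrite normrM ger0_norm// ler_piMr//.
rewrite ler_norml; apply/andP; split.
  rewrite (@le_trans _ _ 0)// ?lerN10// subr_ge0 (le_trans _ t1)// ler_nat.
  exact: geq_minl.
rewrite lerBlDl /n; case: (leqP (Num.truncn (u j)) k) => tk.
  by rewrite natr1 ltW.
by rewrite natr1.
Qed.

End sphere_grid.

(** The boundary of a cube has dimension d - 1, whence the exponent of the number
of points. *)
Lemma sphere_net (R : realType) (d k : nat) (x0 : 'rV[R]_d) (rho : R) :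
  (0 < d)%N -> 0 < rho ->
  exists (I : finType) (g : I -> 'rV[R]_d),
    [/\ #|I| = (d * 2 * k.+1 ^ d.-1)%N,
        forall a, `|g a - x0| = rho &
        forall x, `|x - x0| = rho -> exists a, `|x - g a| <= 2 * rho / k.+1%:R].
Proof.
case: d x0 => // d x0 _ rho0.
exists (@grid_index d k), (@grid_point R d k x0 rho); split.
- exact: card_grid_index.
- exact: grid_point_norm.
- exact: grid_point_near.
Qed.

(** * Regularity of the log-densities *)

Section log_densities.
Context {R : realType} {dO : measure_display} {p : nat} {phi0 : option R}
  {r N : nat}.
Variable m : glmm dO p phi0 r N.
Local Notation d := (glmm_dim p phi0 r).
Local Notation param := 'rV[R]_d.
Variable Theta : set param.
Hypothesis mP : is_glmm m Theta.
Implicit Types (theta : param) (C : {set 'I_N}) (S : {set {set 'I_N}}).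

Lemma marginal_density_gt0 C theta y : Theta theta ->
  (0 < marginal_density m C theta y)%E.
Proof. by move=> Th; rewrite marginal_densityE; exact: (cluster_density_gt0 mP). Qed.

Lemma fine_marginal_density_gt0 C theta y : Theta theta ->
  marginal_density m C theta y \is a fin_num ->
  0 < fine (marginal_density m C theta y).
Proof.
move=> Th yfin; rewrite -lte_fin fineK//.
exact: marginal_density_gt0.
Qed.

Lemma log_ratio_diff C theta theta0 y : Theta theta -> Theta theta0 ->
  marginal_density m C theta y \is a fin_num ->
  marginal_density m C theta0 y \is a fin_num ->
  log_ratio m C theta theta0 y = log_density m C theta y - log_density m C theta0 y.
Proof.
by move=> Th Th0 f f0; rewrite /log_ratio ln_div// posrE fine_marginal_density_gt0.
Qed.

Lemma prod_cluster_ratio S theta theta0 y : Theta theta -> Theta theta0 ->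
  (forall C, C \in S -> marginal_density m C theta y \is a fin_num) ->
  (forall C, C \in S -> marginal_density m C theta0 y \is a fin_num) ->
  \prod_(C in S) cluster_ratio m theta0 theta (subvector C y) =
  expR (- \sum_(C in S) log_ratio m C theta theta0 y).
Proof.
move=> Th Th0 f f0; rewrite -sumrN expR_sum; apply: eq_bigr => C CS.
rewrite /cluster_ratio -!marginal_densityE /log_ratio.
have d1 := fine_marginal_density_gt0 Th (f _ CS).
have d0 := fine_marginal_density_gt0 Th0 (f0 _ CS).
by rewrite expRN lnK ?posrE ?divr_gt0// invf_div.
Qed.

Lemma is_derive_log_density C theta y c : Theta° theta ->
  log_density_has_partials m Theta C theta y ->
  is_derive theta (unitv c) (fun th => log_density m C th y)
    (partial Theta (fun th => log_density m C th y) theta c).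
Proof.
move=> Th [_ part]; apply: interior_derivable => //.
by apply: part; exact: interior_admissible.
Qed.

Variables (theta0 : param) (rho : R).
Hypothesis rho0 : 0 <= rho.
Hypothesis cube_interior : forall theta, `|theta - theta0| <= rho -> Theta° theta.

(** Serves for the clusters of a subset, and for the full data when S has the
single element [set: 'I_N]. *)
Lemma lipschitz_log_density_sum S y (L : R) :
  (forall theta C, `|theta - theta0| <= rho -> C \in S ->
    log_density_has_partials m Theta C theta y) ->
  (forall theta, `|theta - theta0| <= rho ->
    \sum_(C in S) score_norm m Theta C theta y <= L) ->
  forall theta theta',
    `|theta - theta0| <= rho -> `|theta' - theta0| <= rho ->
  `|\sum_(C in S) log_density m C theta y -
    \sum_(C in S) log_density m C theta' y| <= L * d%:R * `|theta - theta'|.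
Proof.
move=> part scoreL theta theta' th th'.
pose dF th c := \sum_(C in S) partial Theta (fun th => log_density m C th y) th c.
apply: (lipschitz_cube (dF := dF) (F := fun th => \sum_(C in S) log_density m C th y)
  (x0 := theta0) (rho := rho)) => // {th th' theta theta'} theta c th.
  rewrite (_ : (fun th => _) = \sum_(i < #|S|)
    (fun th => log_density m (enum_val i) th y)); last first.
    by apply/funext => t; rewrite fct_sumE big_enum_val.
  rewrite (_ : dF theta c = \sum_(i < #|S|)
      partial Theta (fun th => log_density m (enum_val i) th y) theta c); last first.
    by rewrite /dF big_enum_val.
  apply: is_derive_sum => i; apply: is_derive_log_density; first exact: cube_interior.
  by apply: part => //; exact: enum_valP.
apply: le_trans (scoreL _ th); apply: (le_trans (ler_norm_sum _ _ _)).
apply: ler_sum => C CS; apply: partial_le_max; exact: cube_interior.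
Qed.

End log_densities.

(** * Outer probabilities *)

Section outer_probability.
Local Open Scope ereal_scope.
Context {R : realType}.

Lemma cvge0_le (u : nat -> \bar R) : u @ \oo --> 0 ->
  forall e : R, (0 < e)%R -> \forall N \near \oo, u N <= e%:E.
Proof.
move=> u0 e e0; have : ereal_nbhs (0 : \bar R) (fun x => x < e%:E).
  by apply: open_ereal_lt'; rewrite lte_fin.
move=> /u0 ue; near=> N; apply/ltW; near: N; exact: ue.
Unshelve. all: by end_near.
Qed.

Lemma cvge0_of_le (u : nat -> \bar R) : (forall N, 0 <= u N) ->
  (forall e : R, (0 < e)%R -> \forall N \near \oo, u N <= e%:E) ->
  u @ \oo --> 0.
Proof.
move=> u0 ue; apply/fine_cvgP; split.
  have := ue _ ltr01; apply: filterS => N uN.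
  by rewrite ge0_fin_numE// (le_lt_trans uN)// ltry.
apply/cvgrPdist_le => e e0; have := ue _ e0; apply: filterS => N uN.
rewrite sub0r normrN ger0_norm ?fine_ge0// -lee_fin fineK//.
by rewrite ge0_fin_numE// (le_lt_trans uN)// ltry.
Qed.

Section one_probability.
Context d (T : measurableType d) (P : probability T R).
Local Notation "'P^*'" := (mu_ext P).

Lemma outer_probability_ge0 A : 0 <= P^* A.
Proof. exact: mu_ext_ge0. Qed.

Lemma le_outer_probability A B : A `<=` B -> P^* A <= P^* B.
Proof. exact: le_mu_ext. Qed.

Lemma outer_probabilityE A : measurable A -> P^* A = P A.
Proof. exact: measurable_mu_extE. Qed.

Lemma outer_probabilityU A B : P^* (A `|` B) <= P^* A + P^* B.
Proof. exact: outer_measureU2. Qed.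

Lemma outer_probability_bigcup (I : finType) (A : I -> set T) :
  P^* [set w | exists i, A i w] <= \sum_i P^* (A i).
Proof.
pose F (n : nat) : set T := [set w | exists2 i : I, enum_rank i = n :> nat & A i w].
have FE (k : 'I_#|I|) : F k = A (enum_val k).
  apply/seteqP; split => w /=.
    by move=> [i /val_inj <-]; rewrite enum_rankK.
  by move=> Aw; exists (enum_val k) => //; rewrite enum_valK.
apply: (@le_trans _ _ (P^* (\big[setU/set0]_(k < #|I|) F k))).
  apply: le_outer_probability => w [i Aiw].
  rewrite -bigcup_mkord; exists (enum_rank i); first exact: ltn_ord.
  by exists i.
apply: le_trans (outer_measure_subadditive _ F #|I|) _.
have -> : \sum_i P^* (A i) = \sum_(k < #|I|) P^* (A (enum_val k)).
  by rewrite -(big_enum_val (fun i => P^* (A i))); apply: eq_bigl.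
by apply: lee_sum => k _; rewrite FE.
Qed.

Lemma outer_probability_negligible A : P.-negligible A -> P^* A = 0.
Proof.
move=> [B [mB PB0 AB]]; apply/eqP; rewrite eq_le outer_probability_ge0 andbT.
by rewrite (le_trans (le_outer_probability AB))// outer_probabilityE// PB0.
Qed.

(** Turns a bound on probabilities into the existence of an outcome; this is how
statements on means are obtained from statements on random averages. *)
Lemma outer_probability_inhabited A : P^* A < 1 -> exists w, ~ A w.
Proof.
move=> PA; apply/existsNP => AT.
have : A = setT by apply/seteqP; split.
by move: PA => /[swap] ->; rewrite outer_probabilityE// probability_setT ltxx.
Qed.

End one_probability.

Section sequences_of_events.
Context {disp : nat -> measure_display}
  {T : forall N, measurableType (disp N)} (P : forall N, probability (T N) R).
Implicit Types A B : forall N, set (T N).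

Lemma outer_tends_to_zeroP A : tends_to_zero_in_outer_probability P A <->
  forall e : R, (0 < e)%R -> \forall N \near \oo, mu_ext (P N) (A N) <= e%:E.
Proof.
split; first exact: cvge0_le.
by apply: cvge0_of_le => N; exact: outer_probability_ge0.
Qed.

Lemma outer_tends_to_zeroS A B : (\forall N \near \oo, A N `<=` B N) ->
  tends_to_zero_in_outer_probability P B -> tends_to_zero_in_outer_probability P A.
Proof.
move=> AB /outer_tends_to_zeroP B0; apply/outer_tends_to_zeroP => e e0.
near=> N; apply: (@le_trans _ _ (mu_ext (P N) (B N))).
  by apply: le_outer_probability; near: N.
by near: N; exact: B0.
Unshelve. all: by end_near. Qed.

Lemma outer_tends_to_zeroU A B :
  tends_to_zero_in_outer_probability P A -> tends_to_zero_in_outer_probability P B ->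
  tends_to_zero_in_outer_probability P (fun N => A N `|` B N).
Proof.
move=> /outer_tends_to_zeroP A0 /outer_tends_to_zeroP B0.
apply/outer_tends_to_zeroP => e e0.
near=> N; apply: le_trans (outer_probabilityU _ _ _) _.
rewrite [e]splitr EFinD leeD//; near: N; [apply: A0|apply: B0];
by rewrite divr_gt0.
Unshelve. all: by end_near. Qed.

Lemma outer_tends_to_zero_bigcup (I : finType) (A : I -> forall N, set (T N)) :
  (forall i, tends_to_zero_in_outer_probability P (A i)) ->
  tends_to_zero_in_outer_probability P (fun N => [set w | exists i, A i N w]).
Proof.
move=> A0; apply/outer_tends_to_zeroP => e e0.
have eI : (0 < e / #|I|.+1%:R)%R by rewrite divr_gt0// ltr0n.
have : \forall N \near \oo, forall i : I, mu_ext (P N) (A i N) <= (e / #|I|.+1%:R)%:E.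
  by apply: filter_forall => i; have /outer_tends_to_zeroP := A0 i; exact.
apply: filterS => N AN.
apply: le_trans (outer_probability_bigcup _ _) _.
apply: (@le_trans _ _ (\sum_(i : I) (e / #|I|.+1%:R)%:E)).
  by apply: lee_sum => i _; exact: AN.
rewrite sumEFin lee_fin sumr_const -[X in (X <= _)%R]mulr_natr mulrAC ler_pdivrMr ?ltr0n//.
by apply: ler_wpM2l; [exact: ltW|rewrite ler_nat].
Qed.

End sequences_of_events.
End outer_probability.

(** * Uniform law of large numbers on the boundary of a cube *)

Section uniform_law.
Context {R : realType} {p r : nat} {phi0 : option R}
  {disp : nat -> measure_display}.
Variable model : forall N : nat, glmm (disp N) p phi0 r N.
Local Notation d := (glmm_dim p phi0 r).
Local Notation param := 'rV[R]_d.
Variables (Theta : set param) (theta0 : param) (M rho : R).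
Hypothesis dim_gt0 : (0 < d)%N.
Hypothesis modelP : forall N, is_glmm (model N) Theta.
Hypothesis rho_gt0 : 0 < rho.
Hypothesis rhoM : d%:R * rho <= M.
Hypothesis cube_interior : forall theta, `|theta - theta0| <= rho -> Theta° theta.

Lemma cube_param theta : `|theta - theta0| <= rho -> Theta theta.
Proof. by move=> /cube_interior /interior_subset. Qed.

Lemma cube_enorm_le theta : `|theta - theta0| <= rho -> enorm (theta - theta0) <= M.
Proof.
move=> th; apply: le_trans (enorm_le_norm _) _; apply: le_trans rhoM.
exact: ler_wpM2l.
Qed.

Lemma cube_center : `|theta0 - theta0| <= rho.
Proof. by rewrite subrr normr0 ltW. Qed.

Local Notation P N := (law (model N) theta0).

Variables (S : forall N : nat, {set {set 'I_N}}) (sa : nat -> R).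
Hypothesis indep : forall N, independent_clusters (model N) (S N) theta0.
Hypothesis S_card : #|S N| @[N --> \oo] --> \oo.
Hypothesis partials : forall N,
    {ae P N, forall w, forall theta,
      Theta theta -> enorm (theta - theta0) <= M ->
      forall C : {set 'I_N}, C \in S N ->
        log_density_has_partials (model N) Theta C theta (resp (model N) w)}.
Hypothesis sa_gt0 : forall N, 0 < sa N.
Hypothesis sa_away0 : (1 < d)%N ->
  exists2 k : R, 0 < k & \forall N \near \oo, k <= sa N.
Hypothesis score_clusters : littleo_P (fun N => P N)
  (fun N w => ereal_sup [set
      (#|S N|%:R^-1 * \sum_(C in S N)
         score_norm (model N) Theta C theta (resp (model N) w))%:E
    | theta in [set theta | Theta theta /\ enorm (theta - theta0) <= M]])
  sa.
Hypothesis variance_small :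
  (ereal_sup [set
      (sa N ^+ d.-1 / #|S N|%:R ^+ 2)%:E *
      \sum_(C in S N)
        'V_(P N) [fun w => log_ratio (model N) C theta theta0 (resp (model N) w)]
    | theta in [set theta | Theta theta /\ (enorm (theta - theta0) <= M)%R]]
   @[N --> \oo] --> 0)%E.

Definition avg_log_ratio N theta (w : sample (model N)) : R :=
  #|S N|%:R^-1 *
  \sum_(C in S N) log_ratio (model N) C theta theta0 (resp (model N) w).

Definition mean_log_ratio N theta : R :=
  #|S N|%:R^-1 * \sum_(C in S N)
    fine 'E_(P N) [fun w => log_ratio (model N) C theta theta0 (resp (model N) w)].

Arguments avg_log_ratio : clear implicits.

Lemma measurable_avg_deviation N theta (e c : R) : `|theta - theta0| <= rho ->
  measurable [set w | e <= `|avg_log_ratio N theta w - c|].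
Proof.
move=> th.
have mf : measurable_fun setT (fun w => `|avg_log_ratio N theta w - c|).
  apply: measurableT_comp => //; apply: measurable_funB => //.
  apply: measurable_funM => //.
  exact: (measurable_sum_log_ratio (modelP N) (S N) (cube_param th) (cube_param cube_center)).
rewrite -[X in measurable X]setTI (_ : [set w | _] =
  (fun w => `|avg_log_ratio N theta w - c|) @^-1` `[e, +oo[%classic).
  exact: mf.
by apply/seteqP; split => w /=; rewrite in_itv/= andbT.
Qed.

Lemma card_clusters_gt0 : \forall N \near \oo, (0 < #|S N|)%N.
Proof. exact: (S_card (nbhs_infty_gt 0)). Qed.

(** A vanishing supremum also makes every variance finite for large N. *)
Lemma cluster_variances (e : R) : 0 < e -> \forall N \near \oo,
  forall theta, `|theta - theta0| <= rho ->
  (forall C, C \in S N ->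
    'V_(P N) [fun w => log_ratio (model N) C theta theta0 (resp (model N) w)] < +oo)%E /\
  ((#|S N|%:R ^- 2)%:E * \sum_(C in S N)
    'V_(P N) [fun w => log_ratio (model N) C theta theta0 (resp (model N) w)]
    <= (e / sa N ^+ d.-1)%:E)%E.
Proof.
move=> e0; near=> N => theta th.
have m0 : (0 < #|S N|)%N by near: N; exact: card_clusters_gt0.
have sd0 : 0 < sa N ^+ d.-1 by rewrite exprn_gt0.
have m2 : 0 < #|S N|%:R ^- 2 :> R by rewrite invr_gt0 exprn_gt0// ltr0n.
set V := (\sum_(C in S N) _)%E.
have Vle : ((sa N ^+ d.-1 / #|S N|%:R ^+ 2)%:E * V <= e%:E)%E.
  apply: (@le_trans _ _ (ereal_sup [set
      (sa N ^+ d.-1 / #|S N|%:R ^+ 2)%:E *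
      \sum_(C in S N)
        'V_(P N) [fun w => log_ratio (model N) C theta theta0 (resp (model N) w)]
    | theta in [set theta | Theta theta /\ (enorm (theta - theta0) <= M)%R]])%E).
    apply: ereal_sup_ubound; exists theta => //=.
    by split; [exact: cube_param|exact: cube_enorm_le].
  by near: N; exact: (cvge0_le variance_small e0).
have sm0 : 0 < sa N ^+ d.-1 / #|S N|%:R ^+ 2 by rewrite mulr_gt0.
have V0 C : (0 <= 'V_(P N) [fun w => log_ratio (model N) C theta theta0 (resp (model N) w)])%E.
  exact: variance_ge0.
split.
  move=> C CS; apply: (@le_lt_trans _ _ V).
    by rewrite /V (bigD1 C)//= leeDl// sume_ge0.
  rewrite ltNge leye_eq; apply/eqP => Voo; move: Vle.
  by rewrite Voo gt0_muley// leye_eq.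
by rewrite [e / _]mulrC EFinM lee_pdivlMl// muleA -EFinM.
Unshelve. all: by end_near. Qed.

Lemma cluster_expectations : \forall N \near \oo,
  forall theta, `|theta - theta0| <= rho ->
  ((#|S N|%:R^-1)%:E * \sum_(C in S N)
    'E_(P N) [fun w => log_ratio (model N) C theta theta0 (resp (model N) w)]
  = (mean_log_ratio N theta)%:E)%E.
Proof.
have := cluster_variances ltr01; apply: filterS => N V theta th.
have [Voo _] := V _ th.
rewrite /mean_log_ratio EFinM -sumEFin; congr (_ * _)%E.
apply: eq_bigr => C CS; rewrite fineK//.
exact: (cluster_expectation_fin_num (modelP N) (cube_param th) (cube_param cube_center) Voo).
Qed.

Lemma avg_log_ratio_chebyshev (e eta : R) : 0 < e -> 0 < eta ->
  \forall N \near \oo, forall theta, `|theta - theta0| <= rho ->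
  (mu_ext (P N) [set w | eta <= `|avg_log_ratio N theta w - mean_log_ratio N theta|]%R
    <= (e / sa N ^+ d.-1)%:E)%E.
Proof.
move=> e0 eta0.
have e'0 : 0 < eta ^+ 2 * e by rewrite mulr_gt0// exprn_gt0.
have := cluster_variances e'0; have := card_clusters_gt0; apply: filterS2 => N m0 V theta th.
have [Voo Vle] := V _ th.
have mR : 0 < #|S N|%:R :> R by rewrite ltr0n.
have em0 : 0 < #|S N|%:R * eta by rewrite mulr_gt0.
have := clusters_chebyshev (modelP N) (cube_param th) (cube_param cube_center) (@indep N) Voo em0.
move=> cheb; rewrite outer_probabilityE; last exact: measurable_avg_deviation.
rewrite [X in P N X](_ : _ = [set w | #|S N|%:R * eta <=
    `|\sum_(C in S N) log_ratio (model N) C theta theta0 (resp (model N) w) -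
      \sum_(C in S N) fine 'E_(P N)
        [fun w => log_ratio (model N) C theta theta0 (resp (model N) w)]|]); last first.
  by apply/seteqP; split => w /=; rewrite /avg_log_ratio /mean_log_ratio;
    rewrite -mulrBr normrM gtr0_norm ?invr_gt0// ler_pdivlMl.
apply: (le_trans cheb).
rewrite exprMn invfM [X in X%:E]mulrC EFinM -muleA.
rewrite lee_pdivrMl ?exprn_gt0//.
by rewrite -EFinM mulrA.
Qed.

(** The score bound holds with any multiple of sa; the multiple 1 is enough, as
the mesh of the net will be chosen accordingly. *)
Lemma avg_log_ratio_lipschitz :
  tends_to_zero_in_outer_probability (fun N => P N) (fun N => [set w |
    ~ forall theta theta', `|theta - theta0| <= rho -> `|theta' - theta0| <= rho ->
      `|avg_log_ratio N theta w - avg_log_ratio N theta' w| <=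
        sa N * d%:R * `|theta - theta'|]).
Proof.
have part0 : tends_to_zero_in_outer_probability (fun N => P N) (fun N =>
    ~` [set w | forall theta, Theta theta -> enorm (theta - theta0) <= M ->
      forall C : {set 'I_N}, C \in S N ->
        log_density_has_partials (model N) Theta C theta (resp (model N) w)]).
  rewrite /tends_to_zero_in_outer_probability.
  under eq_fun do rewrite (outer_probability_negligible (@partials _)).
  exact: cvg_cst.
have := outer_tends_to_zeroU (score_clusters ltr01) part0.
apply: outer_tends_to_zeroS.
have := card_clusters_gt0; apply: filterS => N m0 w /= nosc.
apply: contrapT => /not_orP[score /contrapT part]; apply: nosc => theta theta' th th'.
have mR : 0 < #|S N|%:R :> R by rewrite ltr0n.
have fin t : `|t - theta0| <= rho -> forall C, C \in S N ->
    marginal_density (model N) C t (resp (model N) w) \is a fin_num.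
  by move=> tr C CS; have [] := part _ (cube_param tr) (cube_enorm_le tr) C CS.
rewrite /avg_log_ratio -mulrBr normrM gtr0_norm ?invr_gt0// ler_pdivrMl//.
have -> : \sum_(C in S N) log_ratio (model N) C theta theta0 (resp (model N) w) -
    \sum_(C in S N) log_ratio (model N) C theta' theta0 (resp (model N) w) =
    \sum_(C in S N) log_density (model N) C theta (resp (model N) w) -
    \sum_(C in S N) log_density (model N) C theta' (resp (model N) w).
  rewrite -!sumrB; apply: eq_bigr => C CS.
  rewrite !(log_ratio_diff (modelP N))//; first by rewrite opprB addrA subrK.
  - exact: cube_param.
  - exact/cube_param/cube_center.
  - exact: fin.
  - exact/fin/CS/cube_center.
  - exact: cube_param.
  - exact/cube_param/cube_center.
  - exact: fin.
  - exact/fin/CS/cube_center.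
rewrite !mulrA.
apply: (lipschitz_log_density_sum (ltW rho_gt0) cube_interior) => // [t C tr CS|t tr].
  by apply: part => //; [exact: cube_param|exact: cube_enorm_le].
rewrite -ler_pdivrMl// -lee_fin.
move/negP : score; rewrite -leNgt mul1r => score.
apply: le_trans score; apply: le_trans (lee_abs _).
by apply: ereal_sup_ubound; exists t => //; split; [exact: cube_param|exact: cube_enorm_le].
Qed.

(** When d > 1, the term 1 that comes from rounding up the number of points per
axis is absorbed thanks to the lower bound on sa. *)
Lemma net_size (c : R) : 0 <= c -> exists2 K : R, 0 < K &
  \forall N \near \oo,
    (d * 2 * (Num.truncn (c * sa N)).+1 ^ d.-1)%:R <= K * sa N ^+ d.-1.
Proof.
move=> c0; have d2 : 0 < (d * 2)%:R :> R by rewrite ltr0n muln_gt0 dim_gt0.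
have [d1|d1] := leqP d 1.
  exists (d * 2)%:R => //; near=> N.
  have -> : d.-1 = 0%N by rewrite -subn1; apply/eqP; rewrite subn_eq0.
  by rewrite expn0 muln1 expr0 mulr1.
have [k k0 ksa] := sa_away0 d1.
exists ((d * 2)%:R * (c + k^-1) ^+ d.-1).
  by rewrite mulr_gt0// exprn_gt0// ltr_wpDl// invr_gt0.
move: ksa; apply: filterS => N ksa.
rewrite natrM -mulrA; apply: ler_wpM2l; first exact: ltW.
rewrite natrX -exprMn lerXn2r ?nnegrE//.
  by apply: mulr_ge0; apply: ltW => //; rewrite ltr_wpDl// invr_gt0.
have csa : 0 <= c * sa N by rewrite mulr_ge0// ltW.
have /andP[t _] := truncn_itv csa.
by rewrite -natr1 mulrDl lerD// ler_pdivlMl// mulr1.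
Unshelve. all: by end_near. Qed.

Lemma sa_pow_away : exists2 k : R, 0 < k &
  \forall N \near \oo, k <= sa N ^+ d.-1.
Proof.
have [d1|d1] := leqP d 1.
  exists 1 => //; near=> N.
  have -> : d.-1 = 0%N by rewrite -subn1; apply/eqP; rewrite subn_eq0.
  by rewrite expr0.
have [k k0 ksa] := sa_away0 d1.
exists (k ^+ d.-1); first by rewrite exprn_gt0.
by move: ksa; apply: filterS => N ksa; rewrite lerXn2r ?nnegrE// ltW.
Unshelve. all: by end_near. Qed.

(** The scores are bounded in probability only.  With probability at least 1/4,
however, the two averages are within eta of each other and of their means, and
one such outcome suffices to compare the means. *)
Lemma mean_log_ratio_oscillation (eta : R) : 0 < eta -> \forall N \near \oo,
  forall theta theta', `|theta - theta0| <= rho -> `|theta' - theta0| <= rho ->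
  sa N * d%:R * `|theta - theta'| <= eta ->
  `|mean_log_ratio N theta - mean_log_ratio N theta'| <= 3 * eta.
Proof.
move=> eta0; have [k k0 ksa] := sa_pow_away.
have e0 : 0 < k / 4 by rewrite divr_gt0.
have cheb := avg_log_ratio_chebyshev e0 eta0.
have /outer_tends_to_zeroP/(_ (1/4)) := avg_log_ratio_lipschitz.
rewrite divr_gt0// => /(_ isT) lip.
near=> N => theta theta' th th' close.
have ek : k / 4 / sa N ^+ d.-1 <= 1 / 4.
  have kN : k <= sa N ^+ d.-1 by near: N.
  by rewrite ler_pdivrMr ?exprn_gt0//; lra.
have chN t : `|t - theta0| <= rho -> (mu_ext (P N)
    [set w | eta <= `|avg_log_ratio N t w - mean_log_ratio N t|]%R <= (1/4)%:E)%E.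
  move=> tr; apply: (@le_trans _ _ (k / 4 / sa N ^+ d.-1)%:E); last by rewrite lee_fin.
  by move: t tr; near: N.
have lipN : (mu_ext (P N) [set w |
    (~ forall theta theta', `|theta - theta0| <= rho -> `|theta' - theta0| <= rho ->
      `|avg_log_ratio N theta w - avg_log_ratio N theta' w| <=
        sa N * d%:R * `|theta - theta'|)%R] <= (1/4)%:E)%E.
  by near: N.
have tot : ((1/4)%:E + (1/4)%:E + (1/4)%:E < 1 :> \bar R)%E.
  by rewrite -!EFinD lte_fin; lra.
have := le_lt_trans (le_trans (outer_probabilityU _ _ _)
  (leeD (le_trans (outer_probabilityU _ _ _) (leeD lipN (chN _ th))) (chN _ th'))) tot.
move=> /outer_probability_inhabited[w].
move=> /not_orP[/not_orP[/contrapT w1 /negP w2] /negP w3].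
move: w2 w3; rewrite -!ltNge => w2 w3.
have := w1 _ _ th th'; move: w2 w3 close; rewrite !ltr_norml !ler_norml.
move=> /andP[? ?] /andP[? ?] ? /andP[? ?].
by apply/andP; split; lra.
Unshelve. all: by end_near. Qed.

(** From theta to a point of the net, 3 eta for the means and eta for the averages
are lost; Chebyshev costs eta at the point of the net. *)
Lemma avg_log_ratio_uniform (eta : R) : 0 < eta ->
  tends_to_zero_in_outer_probability (fun N => P N) (fun N => [set w |
    ~ forall theta, `|theta - theta0| = rho ->
      `|avg_log_ratio N theta w - mean_log_ratio N theta| <= 5 * eta]).
Proof.
move=> eta0; apply/outer_tends_to_zeroP => e e0.
(* with c * sa N points per axis, the Lipschitz bound between a point of the
   boundary and the net is at most eta *)
pose c := 2 * rho * d%:R / eta.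
have c0 : 0 <= c by rewrite divr_ge0 ?mulr_ge0// ltW.
have [K K0 netK] := net_size c0.
have e20 : 0 < e / 2 by rewrite divr_gt0.
have e1 : 0 < e / 2 / K by rewrite divr_gt0.
have cheb := avg_log_ratio_chebyshev e1 eta0.
have /outer_tends_to_zeroP/(_ _ e20) lip := avg_log_ratio_lipschitz.
have osc := mean_log_ratio_oscillation eta0.
near=> N.
have chebN theta : `|theta - theta0| <= rho ->
    (mu_ext (P N) [set w | eta <= `|avg_log_ratio N theta w - mean_log_ratio N theta|]%R
    <= (e / 2 / K / sa N ^+ d.-1)%:E)%E by move: theta; near: N.
have netN : (d * 2 * (Num.truncn (c * sa N)).+1 ^ d.-1)%:R <= K * sa N ^+ d.-1.
  by near: N.
have [I [g [cardI g_norm g_near]]] :=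
  sphere_net (Num.truncn (c * sa N)) theta0 dim_gt0 rho_gt0.
have g_cube i : `|g i - theta0| <= rho by rewrite g_norm.
have csa : 0 <= c * sa N by rewrite mulr_ge0// ltW.
have sd0 : 0 < sa N ^+ d.-1 by rewrite exprn_gt0.
pose dev i : set (sample (model N)) :=
  [set w | eta <= `|avg_log_ratio N (g i) w - mean_log_ratio N (g i)|].
have dev_small : (mu_ext (P N) [set w | exists i, dev i w] <= (e / 2)%:E)%E.
  apply: le_trans (outer_probability_bigcup _ _) _.
  apply: (@le_trans _ _ (\sum_(i : I) (e / 2 / K / sa N ^+ d.-1)%:E)%E).
    by apply: lee_sum => i _; exact: chebN.
  rewrite sumEFin lee_fin sumr_const -[X in X <= _]mulr_natl cardI.
  move: (sa N ^+ d.-1) sd0 netN => sd sd0 netN.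
  apply: (@le_trans _ _ (K * sd * (e / 2 / K / sd))).
    by apply: ler_wpM2r => //; rewrite ltW// !divr_gt0.
  by rewrite le_eqVlt; apply/orP; left; apply/eqP; field; rewrite !gt_eqF.
have lipN : (mu_ext (P N) [set w |
    (~ forall theta theta', `|theta - theta0| <= rho -> `|theta' - theta0| <= rho ->
      `|avg_log_ratio N theta w - avg_log_ratio N theta' w| <=
        sa N * d%:R * `|theta - theta'|)%R] <= (e / 2)%:E)%E.
  by near: N.
have oscN theta theta' : `|theta - theta0| <= rho -> `|theta' - theta0| <= rho ->
    sa N * d%:R * `|theta - theta'| <= eta ->
    `|mean_log_ratio N theta - mean_log_ratio N theta'| <= 3 * eta.
  by move: theta theta'; near: N.
rewrite [e in X in (_ <= X)%E]splitr EFinD.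
apply: le_trans (le_trans (outer_probabilityU _ _ _) (leeD lipN dev_small)).
apply: le_outer_probability => w /= bad; apply: contrapT.
move=> /not_orP[/contrapT lip_w nodev]; apply: bad => theta th.
have [i near_i] := g_near _ th.
have th' : `|theta - theta0| <= rho by rewrite th.
have close : sa N * d%:R * `|theta - g i| <= eta.
  apply: (@le_trans _ _ (sa N * d%:R * (2 * rho / (Num.truncn (c * sa N)).+1%:R))).
    by apply: ler_wpM2l => //; rewrite mulr_ge0// ltW.
  rewrite mulrA ler_pdivrMr ?ltr0n//.
  have /andP[_ /ltW t] := truncn_itv csa.
  apply: (@le_trans _ _ (eta * (c * sa N))); last by apply: ler_wpM2l; [exact: ltW|].
  by rewrite /c le_eqVlt; apply/orP; left; apply/eqP; field; rewrite gt_eqF.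
have d1 := lip_w _ _ th' (g_cube i); have d2 := oscN _ _ th' (g_cube i) close.
have d3 : `|avg_log_ratio N (g i) w - mean_log_ratio N (g i)| < eta.
  by rewrite ltNge; apply/negP => dev_i; apply: nodev; exists i.
move: (le_trans d1 close) d2 d3; rewrite !ltr_norml !ler_norml.
move=> /andP[? ?] /andP[? ?] /andP[? ?].
by apply/andP; split; lra.
Unshelve. all: by end_near. Qed.

End uniform_law.
Arguments avg_log_ratio {R p r phi0 disp} model theta0 S N theta w.

(** * Subexponential size of the nets *)

Section smallest_subset.
Context {b : nat} (m : 'I_b -> nat -> nat).

Definition min_card (N : nat) : nat :=
  \big[minn/(\max_(a < b) m a N)%N]_(a < b) m a N.

Lemma min_card_le a N : (min_card N <= m a N)%N.
Proof.
rewrite /min_card; move: (\max_(a < b) m a N)%N => x0.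
have : a \in index_enum 'I_b by rewrite mem_index_enum.
elim: (index_enum _) => // i l IH; rewrite big_cons inE => /predU1P[->|/IH al].
  exact: geq_minl.
exact: leq_trans (geq_minr _ _) al.
Qed.

Lemma min_card_infty (b0 : (0 < b)%N) : (forall a, m a N @[N --> \oo] --> \oo) ->
  forall n, \forall N \near \oo, (n <= min_card N)%N.
Proof.
move=> moo n.
have mn a : \forall N \near \oo, (n <= m a N)%N.
  exact: (moo a _ (nbhs_infty_ge n)).
have mn' : \forall N \near \oo, forall a, (n <= m a N)%N by exact: filter_forall.
near=> N; have mN : forall a, (n <= m a N)%N by near: N.
rewrite /min_card.
apply: (big_ind (fun x => n <= x)%N) => [|x y nx ny|a _]; [|by rewrite leq_min nx|exact: mN].
exact: leq_trans (mN (Ordinal b0)) (@leq_bigmax _ (fun a => m a N) (Ordinal b0)).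
Unshelve. all: by end_near. Qed.

End smallest_subset.

Section subexponential.
Context {R : realType}.

(** As ln (s N) = o(mu N), the number of points is at most a constant times
expR (k / 2 * mu N). *)
Lemma subexponential_net (d : nat) (s : nat -> R) (mu : nat -> nat) (c k e : R) :
  (0 < d)%N -> (forall N, 0 < s N) -> 0 <= c -> 0 < k -> 0 < e ->
  (forall n, \forall N \near \oo, (n <= mu N)%N) ->
  ln (s N) / (mu N)%:R @[N --> \oo] --> 0 ->
  \forall N \near \oo,
    (d * 2 * (Num.truncn (c * s N)).+1 ^ d.-1)%:R * expR (1 - k * (mu N)%:R) <= e.
Proof.
move=> d0 s0 c0 k0 e0 muoo lnsmu.
have dR : 0 < d%:R :> R by rewrite ltr0n.
(* chosen so that d * k' = k / 2 *)
pose k' := k / (2 * d%:R).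
have k'0 : 0 < k' by rewrite divr_gt0// mulr_gt0.
pose A := (d * 2)%:R * (c + 1) ^+ d.-1 * expR 1.
have A0 : 0 < A.
  apply: mulr_gt0; last exact: expR_gt0.
  by apply: mulr_gt0; rewrite ?ltr0n ?muln_gt0 ?d0// exprn_gt0// ltr_wpDl.
have kA : 0 < 2 * A / (e * k) by apply: divr_gt0; exact: mulr_gt0.
near=> N.
have mu0 : (0 < mu N)%N by near: N; exact: muoo.
have muR : 0 < (mu N)%:R :> R by rewrite ltr0n.
have muA : 2 * A / (e * k) <= (mu N)%:R.
  have : ((Num.truncn (2 * A / (e * k))).+1 <= mu N)%N by near: N; exact: muoo.
  have /andP[_ /ltW] := truncn_itv (ltW kA).
  by move=> t1 t2; apply: le_trans t1 _; rewrite ler_nat.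
have lns : ln (s N) <= k' * (mu N)%:R.
  rewrite -ler_pdivrMr//; near: N.
  by move: lnsmu => /cvgrPdist_le/(_ _ k'0); apply: filterS => N;
    rewrite sub0r normrN; apply: le_trans; exact: ler_norm.
set x := k' * (mu N)%:R in lns.
have x0 : 0 <= x by rewrite mulr_ge0 ?ltW.
have sx : s N <= expR x by rewrite -[leLHS]lnK ?posrE// ler_expR.
have ex1 : 1 <= expR x by rewrite -expR0 ler_expR.
have step : (Num.truncn (c * s N)).+1%:R <= (c + 1) * expR x.
  have cs : 0 <= c * s N by rewrite mulr_ge0// ltW.
  have /andP[t _] := truncn_itv cs.
  by rewrite -natr1 mulrDl mul1r lerD// (le_trans t)// ler_wpM2l.
rewrite natrM natrX.
apply: (@le_trans _ _ ((d * 2)%:R * ((c + 1) * expR x) ^+ d.-1 * expR (1 - k * (mu N)%:R))).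
  rewrite ler_wpM2r ?expR_ge0// ler_wpM2l// lerXn2r ?nnegrE//.
  by rewrite mulr_ge0 ?expR_ge0// addr_ge0.
rewrite exprMn -expRM_natl mulrA -mulrA -expRD.
apply: (@le_trans _ _ ((d * 2)%:R * (c + 1) ^+ d.-1 * expR (1 - k / 2 * (mu N)%:R))).
  rewrite ler_wpM2l ?mulr_ge0 ?exprn_ge0 ?addr_ge0// ler_expR.
  have xE : k / 2 * (mu N)%:R = d%:R * x.
    by rewrite /x /k'; field; rewrite gt_eqF.
  have dx : d.-1%:R * x <= d%:R * x by rewrite ler_wpM2r// ler_nat leq_pred.
  by rewrite -mulr_natl; lra.
rewrite expRD mulrA -/A expRN ler_pdivrMr ?expR_gt0//.
apply: (@le_trans _ _ (e * (1 + k / 2 * (mu N)%:R))); last first.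
  by rewrite ler_wpM2l ?expR_ge1Dx// ltW.
rewrite mulrDr mulr1 (le_trans _ (_ : e * (k / 2 * (mu N)%:R) <= _))//; last by rewrite lerDr ltW.
move: muA; rewrite ler_pdivrMr ?mulr_gt0//; lra.
Unshelve. all: by end_near. Qed.

End subexponential.

(** * A root in a cube *)

(** A negative upper limit may be -oo, whence a bound by some - e. *)
Lemma limn_esup_lt0 (R : realType) (u : nat -> \bar R) : (limn_esup u < 0)%E ->
  exists2 e : R, 0 < e & \forall N \near \oo, (u N <= (- e)%:E)%E.
Proof.
move=> /ereal_inf_lt[y [V Voo <-] sup0].
have uV N : V N -> (u N <= ereal_sup (u @` V))%E.
  by move=> VN; apply: ereal_sup_ubound; exists N.
move: sup0 uV; case: (ereal_sup _) => [z| |]//= z0 uV.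
  exists (- z); first by rewrite oppr_gt0 -lte_fin.
  by rewrite opprK; apply: filterS Voo => N /uV.
exists 1 => //; apply: filterS Voo => N /uV; rewrite leeNy_eq => /eqP ->.
exact: leNye.
Qed.

Section root_in_cube.
Context {R : realType} {p r b : nat} {phi0 : option R}
  {disp : nat -> measure_display}.
Variable model : forall N : nat, glmm (disp N) p phi0 r N.
Local Notation d := (glmm_dim p phi0 r).
Local Notation param := 'rV[R]_d.
Variables (Theta : set param) (theta0 : param).
Variable S : 'I_b -> forall N : nat, {set {set 'I_N}}.
Variables (M : R) (s : nat -> R) (sa : 'I_b -> nat -> R).
Hypothesis b_gt0 : (0 < b)%N.
Hypothesis dim_gt0 : (0 < d)%N.
Hypothesis modelP : forall N, is_glmm (model N) Theta.
Hypothesis indep : forall a N theta, Theta theta ->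
  independent_clusters (model N) (S a N) theta.
Hypothesis S_card : forall a, #|S a N| @[N --> \oo] --> \oo.
Hypothesis limsup_neg : forall e : R, 0 < e ->
    (limn_esup (fun N =>
      ereal_sup [set
        \big[mine/+oo]_(a < b)
          ((#|S a N|%:R^-1)%:E *
           \sum_(C in S a N)
             'E_(law (model N) theta0)
               [fun w => log_ratio (model N) C theta theta0
                           (resp (model N) w)])
        | theta in [set theta | Theta theta /\
                                (e <= enorm (theta - theta0) <= M)%R]])
     < 0)%E.
Hypothesis partials : forall N,
    {ae law (model N) theta0, forall w, forall theta,
      Theta theta -> enorm (theta - theta0) <= M ->
      forall C : {set 'I_N},
        C = [set: 'I_N]%SET \/ (exists a, C \in S a N) ->
        log_density_has_partials (model N) Theta C theta (resp (model N) w)}.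
Hypothesis s_gt0 : forall N, 0 < s N.
Hypothesis sa_gt0 : forall a N, 0 < sa a N.
Hypothesis sa_away0 : (1 < d)%N -> forall a,
    exists2 k : R, 0 < k & \forall N \near \oo, k <= sa a N.
Hypothesis score : bigO_P (fun N => law (model N) theta0)
    (fun N w => ereal_sup [set
        (score_norm (model N) Theta [set: 'I_N]%SET theta
           (resp (model N) w))%:E
      | theta in [set theta | Theta theta /\ enorm (theta - theta0) <= M]])
    s.
Hypothesis log_s :
    ln (s N) / (\big[minn / (\max_(a < b) #|S a N|)%N]_(a < b) #|S a N|)%:R
      @[N --> \oo] --> 0.
Hypothesis score_clusters : forall a, littleo_P (fun N => law (model N) theta0)
    (fun N w => ereal_sup [set
        (#|S a N|%:R^-1 *
         \sum_(C in S a N)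
           score_norm (model N) Theta C theta (resp (model N) w))%:E
      | theta in [set theta | Theta theta /\ enorm (theta - theta0) <= M]])
    (sa a).
Hypothesis variance_small : forall a,
    (ereal_sup [set
        (sa a N ^+ d.-1 / #|S a N|%:R ^+ 2)%:E *
        \sum_(C in S a N)
          'V_(law (model N) theta0)
            [fun w => log_ratio (model N) C theta theta0 (resp (model N) w)]
      | theta in [set theta | Theta theta /\ (enorm (theta - theta0) <= M)%R]]
     @[N --> \oo] --> 0)%E.

Variable rho : R.
Hypothesis rho_gt0 : 0 < rho.
Hypothesis rhoM : d%:R * rho <= M.
Hypothesis cube_interior : forall theta, `|theta - theta0| <= rho -> Theta° theta.

Local Notation P N := (law (model N) theta0).
Local Notation avg a := (avg_log_ratio model theta0 (S a)).
Local Notation mean a := (mean_log_ratio model theta0 (S a)).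

Let center : Theta theta0.
Proof. by apply: (cube_param cube_interior); exact: cube_center. Qed.

Let in_cube theta : `|theta - theta0| = rho -> `|theta - theta0| <= rho.
Proof. by move=> ->. Qed.

Let cluster_partials a N : {ae P N, forall w, forall theta,
  Theta theta -> enorm (theta - theta0) <= M ->
  forall C : {set 'I_N}, C \in S a N ->
    log_density_has_partials (model N) Theta C theta (resp (model N) w)}.
Proof.
have := partials N; apply: filterS => w part theta Th ThM C CS.
by apply: part => //; right; exists a.
Qed.

Lemma mean_log_ratio_negative : exists2 delta : R, 0 < delta &
  \forall N \near \oo, forall theta, `|theta - theta0| = rho ->
    exists a, mean a N theta <= - delta.
Proof.
have [delta delta0 neg] := limn_esup_lt0 (limsup_neg rho_gt0).
exists delta => //.
have meanE : \forall N \near \oo, forall a theta, `|theta - theta0| <= rho ->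
    ((#|S a N|%:R^-1)%:E * \sum_(C in S a N)
    'E_(P N) [fun w => log_ratio (model N) C theta theta0 (resp (model N) w)]
    = (mean a N theta)%:E)%E.
  by apply: filter_forall => a; exact: (cluster_expectations modelP rho_gt0
    rhoM cube_interior (S_card a) (sa_gt0 a) (variance_small a)).
apply: (filterS2 _ _ meanE neg) => N meanEN negN theta th.
have : (\big[mine/+oo]_(a < b) (mean a N theta)%:E <= (- delta)%:E)%E.
  under eq_bigr do rewrite -meanEN ?in_cube//.
  apply: le_trans negN; apply: ereal_sup_ubound; exists theta => //=; split.
    exact/(cube_param cube_interior)/in_cube.
  by rewrite -{1}th norm_le_enorm/= (cube_enorm_le rhoM)// th.
by move=> /bigmin_leP[|[a _]]; [rewrite leye_eq|rewrite lee_fin; exists a].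
Qed.

Lemma avg_log_ratio_uniform_all (eta : R) : 0 < eta ->
  tends_to_zero_in_outer_probability (fun N => P N) (fun N => [set w | exists a,
    ~ forall theta, `|theta - theta0| = rho ->
      `|avg a N theta w - mean a N theta| <= 5 * eta]).
Proof.
move=> eta0; apply: (outer_tends_to_zero_bigcup (A := fun a N => [set w |
    ~ forall theta, `|theta - theta0| = rho ->
      `|avg a N theta w - mean a N theta| <= 5 * eta])) => a.
exact: (avg_log_ratio_uniform dim_gt0 modelP rho_gt0 rhoM cube_interior
  (fun N => @indep a N theta0 center) (S_card a) (@cluster_partials a) (sa_gt0 a)
  (fun d1 => sa_away0 d1 a) (score_clusters a) (variance_small a) eta0).
Qed.

Lemma full_score_bound N w (L : R) :
  (`|ereal_sup [set
      (score_norm (model N) Theta [set: 'I_N]%SET theta (resp (model N) w))%:E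
      | theta in [set theta | Theta theta /\ (enorm (theta - theta0) <= M)%R]]|
    <= L%:E)%E ->
  forall theta, `|theta - theta0| <= rho ->
    score_norm (model N) Theta [set: 'I_N]%SET theta (resp (model N) w) <= L.
Proof.
move=> sc t tr; rewrite -lee_fin; apply: le_trans sc.
apply: le_trans (lee_abs _); apply: ereal_sup_ubound; exists t => //; split.
  exact: (cube_param cube_interior).
exact: (cube_enorm_le rhoM).
Qed.

(** Outside four events of small outer probability, the log-likelihood at each
point of the fine net is less than its value at theta0 by more than 1, whereas it
differs by at most 1 from its value at the nearby points of the boundary. *)
Lemma likelihood_root_in_cube :
  tends_to_zero_in_outer_probability (fun N => P N) (fun N => [set w |
    ~ exists2 theta, `|theta - theta0| <= rho &
      likelihood_root (model N) Theta (resp (model N) w) theta]).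
Proof.
have [delta delta0 neg] := mean_log_ratio_negative.
(* deviations of 5 * (delta / 10) leave the averages below - delta / 2 *)
have eta0 : 0 < delta / 10 by rewrite divr_gt0.
have k0 : 0 < delta / 2 by rewrite divr_gt0.
have /outer_tends_to_zeroP unif := avg_log_ratio_uniform_all eta0.
apply/outer_tends_to_zeroP => e e0; have e3 : 0 < e / 3 by rewrite divr_gt0.
have [K scoreK] := score e3.
(* the constant K of the stochastic bound may be negative *)
pose L N := (`|K| + 1) * s N.
have L0 N : 0 <= L N by rewrite mulr_ge0 ?addr_ge0// ltW.
(* with c * s N points per axis, the log-likelihood varies by at most 1 between
   a point of the boundary and the net *)
pose c := 2 * rho * d%:R * (`|K| + 1).
have c0 : 0 <= c by rewrite !mulr_ge0 ?addr_ge0// ltW.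
pose mu := min_card (fun a N => #|S a N|).
have net := subexponential_net dim_gt0 s_gt0 c0 k0 e3 (min_card_infty b_gt0 S_card) log_s.
near=> N.
have negN : forall theta, `|theta - theta0| = rho ->
  exists a, mean a N theta <= - delta by near: N; exact: neg.
have unifN : (mu_ext (P N) [set w | exists a,
    ~ forall theta, `|theta - theta0| = rho ->
      `|avg a N theta w - mean a N theta| <= 5 * (delta / 10)]%R <= (e / 3)%:E)%E.
  by near: N; exact: unif.
have scoreN : (mu_ext (P N) [set w | ((L N)%:E < `|ereal_sup [set
        (score_norm (model N) Theta [set: 'I_N]%SET theta (resp (model N) w))%:E
      | theta in [set theta | Theta theta /\ (enorm (theta - theta0) <= M)%R]]|)%E]
    <= (e / 3)%:E)%E.
  apply: (@le_trans _ _ (mu_ext (P N) [set w | ((K * s N)%:E < `|ereal_sup [set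
        (score_norm (model N) Theta [set: 'I_N]%SET theta (resp (model N) w))%:E
      | theta in [set theta | Theta theta /\ (enorm (theta - theta0) <= M)%R]]|)%E])).
    apply: le_outer_probability => w /=; apply: le_lt_trans.
    rewrite lee_fin; apply: ler_wpM2r; first exact: ltW.
    by rewrite (le_trans (ler_norm K))// lerDl.
  by near: N; exact: scoreK.
have netN : (d * 2 * (Num.truncn (c * s N)).+1 ^ d.-1)%:R *
    expR (1 - delta / 2 * (mu N)%:R) <= e / 3 by near: N; exact: net.
have [I [g [cardI g_norm g_near]]] :=
  sphere_net (Num.truncn (c * s N)) theta0 dim_gt0 rho_gt0.
have gT i : Theta (g i) by exact/(cube_param cube_interior)/in_cube.
have /choice[a_ aP] : forall i, exists a, mean a N (g i) <= - delta.
  by move=> i; exact: negN.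
pose bad i : set (sample (model N)) :=
  [set w | (expR (delta / 2 * #|S (a_ i) N|%:R) <= \prod_(C in S (a_ i) N)
        cluster_ratio (model N) theta0 (g i) (subvector C (resp (model N) w)))%R /\
      (marginal_density (model N) [set: 'I_N]%SET theta0 (resp (model N) w) <=
      (expR 1)%:E * marginal_density (model N) [set: 'I_N]%SET (g i) (resp (model N) w))%E].
have bad_small : (mu_ext (P N) [set w | exists i, bad i w] <= (e / 3)%:E)%E.
  apply: le_trans (outer_probability_bigcup _ _) _.
  apply: (@le_trans _ _ (\sum_(i : I) (expR (1 - delta / 2 * (mu N)%:R))%:E)%E).
    apply: lee_sum => i _; rewrite outer_probabilityE; last first.
      exact: measurable_subset_event.
    apply: le_trans (subset_inequality (modelP N) 1 _ (gT i) center (@indep _ _ _ (gT i))) _.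
    rewrite lee_fin ler_expR lerD2l lerN2; apply: ler_wpM2l; first exact: ltW.
    rewrite ler_nat.
    exact: (min_card_le (fun a N => #|S a N|)).
  by rewrite sumEFin lee_fin sumr_const -[X in X <= _]mulr_natl cardI.
have partN := outer_probability_negligible (partials N).
have tot : (mu_ext (P N) ([set w | exists a,
    ~ forall theta, `|theta - theta0| = rho ->
      `|avg a N theta w - mean a N theta| <= 5 * (delta / 10)] `|`
    [set w | ((L N)%:E < `|ereal_sup [set
        (score_norm (model N) Theta [set: 'I_N]%SET theta (resp (model N) w))%:E
      | theta in [set theta | Theta theta /\ (enorm (theta - theta0) <= M)%R]]|)%E] `|`
    [set w | exists i, bad i w] `|`
    ~` [set w | forall theta, Theta theta -> enorm (theta - theta0) <= M ->
      forall C : {set 'I_N},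
        C = [set: 'I_N]%SET \/ (exists a, C \in S a N) ->
        log_density_has_partials (model N) Theta C theta (resp (model N) w)])%R <= e%:E)%E.
  apply: le_trans (outer_probabilityU _ _ _) _; rewrite partN adde0.
  have -> : e = e / 3 + e / 3 + e / 3 by field.
  rewrite !EFinD; apply: le_trans (outer_probabilityU _ _ _) _; apply: leeD => //.
  by apply: le_trans (outer_probabilityU _ _ _) _; exact: leeD.
apply: le_trans tot; apply: le_outer_probability => w /= noroot; apply: contrapT.
move=> /not_orP[/not_orP[/not_orP[goodU goodS] nobad] /contrapT part]; apply: noroot.
pose logp t := log_density (model N) [set: 'I_N]%SET t (resp (model N) w).
have partC t : `|t - theta0| <= rho ->
    log_density_has_partials (model N) Theta [set: 'I_N]%SET t (resp (model N) w).
  move=> tr; apply: part; [exact: (cube_param cube_interior)|exact: (cube_enorm_le rhoM)|].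
  by left.
move/negP : goodS; rewrite -leNgt => /full_score_bound goodS.
have dlogp t j : `|t - theta0| <= rho ->
    is_derive t (unitv j) logp (partial Theta logp t j).
  by move=> tr; apply: is_derive_log_density; [exact: cube_interior|exact: partC].
have dlogpL t j : `|t - theta0| <= rho -> `|partial Theta logp t j| <= L N.
  move=> tr; apply: le_trans (goodS _ tr); apply: partial_le_max.
  exact: cube_interior.
have grid_lt i : logp (g i) + 1 < logp theta0.
  have g_cube := in_cube (g_norm i).
  have fin_g := (partC _ g_cube).1.
  have fin_0 := (partC _ (cube_center theta0 rho_gt0)).1.
  have clusters_fin t : `|t - theta0| <= rho -> forall C, C \in S (a_ i) N ->
      marginal_density (model N) C t (resp (model N) w) \is a fin_num.
    move=> tr C CS; have [] // := part t _ _ C.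
    - exact: (cube_param cube_interior).
    - exact: (cube_enorm_le rhoM).
    - by right; exists (a_ i).
  have : ~ bad i w by move=> bad_i; apply: nobad; exists i.
  move=> /not_andP[]; last first.
    move=> /negP; rewrite -ltNge -(fineK fin_g) -(fineK fin_0) -EFinM lte_fin => lt_p.
    rewrite /logp /log_density.
    have p0 := fine_marginal_density_gt0 (modelP N) (gT i) fin_g.
    rewrite addrC -[X in X + _ < _](expRK 1) -lnM ?posrE ?expR_gt0//.
    rewrite ltr_ln ?posrE ?mulr_gt0 ?expR_gt0//.
    have h := fine_marginal_density_gt0 (modelP N) center fin_0. exact: h.
  move=> /negP; rewrite -ltNge.
  rewrite (prod_cluster_ratio (modelP N) (gT i) center (clusters_fin _ g_cube)
    (clusters_fin _ (cube_center theta0 rho_gt0))).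
  have avg_small : avg (a_ i) N (g i) w <= - (delta / 2).
    have : `|avg (a_ i) N (g i) w - mean (a_ i) N (g i)| <= 5 * (delta / 10).
      by apply: contrapT => dev; apply: goodU; exists (a_ i) => H; apply: dev; exact: H.
    have := aP i; rewrite ler_norml => mean_neg /andP[_ dev].
    by lra.
  rewrite ltr_expR => lt_sum; exfalso; move: lt_sum; apply/negP; rewrite -leNgt.
  move: avg_small; rewrite /avg_log_ratio.
  have [->|m0] := posnP #|S (a_ i) N|.
    by rewrite invr0 mul0r oppr_ge0 => d20; move: k0; rewrite ltNge d20.
  by rewrite ler_pdivrMl ?ltr0n// mulrN lerNr mulrC.
have boundary_lt theta : `|theta - theta0| = rho -> logp theta < logp theta0.
  move=> th; have [i near_i] := g_near _ th.
  apply: le_lt_trans (grid_lt i); rewrite -lerBlDl.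
  apply: le_trans (ler_norm _) _.
  have lip := lipschitz_cube (ltW rho_gt0) dlogp dlogpL (in_cube th) (in_cube (g_norm i)).
  apply: le_trans lip _.
  apply: (@le_trans _ _ (L N * d%:R * (2 * rho / (Num.truncn (c * s N)).+1%:R))).
    by apply: ler_wpM2l => //; rewrite mulr_ge0.
  have cs0 : 0 <= c * s N by rewrite mulr_ge0// ltW.
  have /andP[_ /ltW cs] := truncn_itv cs0.
  rewrite mulrA ler_pdivrMr ?ltr0n// mul1r; apply: le_trans cs.
  by rewrite /c /L le_eqVlt; apply/orP; left; apply/eqP; ring.
have [theta th root] := cube_critical_point (ltW rho_gt0) dlogp dlogpL dim_gt0 boundary_lt.
exists theta => //; split => //; first exact: cube_interior.
exact: (partC _ th).1.
Unshelve. all: by end_near. Qed.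

End root_in_cube.

(** * Consistency *)

(** Infima over the set of roots need not be attained. *)
Lemma near_minimizer (R : realType) (T : Type) (root : set T) (f : T -> R) (t0 : T)
    (e : R) : (forall t, 0 <= f t) -> 0 < e ->
  exists t, root !=set0 -> root t /\ forall t', root t' -> f t <= f t' + e.
Proof.
move=> f0 e0; have [root0|root0] := pselect (root !=set0); last by exists t0.
have inff : has_inf (f @` root).
  split; first by have [t rt] := root0; exists (f t), t.
  by exists 0 => _ [t _ <-].
have [_ [t rt <-] ft] := inf_adherent e0 inff.
exists t => _; split => // t' rt'; apply: ltW; apply: lt_le_trans ft _.
by rewrite lerD2r; apply: ge_inf; [exact: inff.2|exists t'].
Qed.

(** Two requirements on rho: the cube lies inside A, and inside the Euclidean ball
of radius M, as the Euclidean norm is at most d times the sup norm. *)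
Lemma interior_cube (R : realType) (d : nat) (A : set 'rV[R]_d) (x0 : 'rV[R]_d)
    (M : R) : (0 < d)%N -> 0 < M -> A° x0 ->
  exists2 rmax : R, 0 < rmax & forall rho, rho <= rmax ->
    d%:R * rho <= M /\ forall x, `|x - x0| <= rho -> A° x.
Proof.
move=> d0 M0 /nbhs_ballP[e /= e0 eA].
have dR : 0 < d%:R :> R by rewrite ltr0n.
exists (Num.min (e / 2) (M / d%:R)); first by rewrite lt_min !divr_gt0.
move=> rho; rewrite le_min => /andP[rho_e rho_M]; split.
  by rewrite mulrC -ler_pdivlMr.
move=> x xr; apply/nbhs_ballP; exists (e / 2); first by rewrite /= divr_gt0.
move=> y; rewrite -ball_normE/= => xy; apply: eA; rewrite -ball_normE/=.
rewrite -(subrKA x) (le_lt_trans (ler_normD _ _))// [e]splitr ler_ltD//.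
by rewrite distrC (le_trans xr).
Qed.

Theorem theorem4 (R : realType) (p r b : nat) (phi0 : option R)
  (disp : nat -> measure_display)
  (model : forall N : nat, glmm (disp N) p phi0 r N)
  (Theta : set 'rV[R]_(glmm_dim p phi0 r))
  (theta0 : 'rV[R]_(glmm_dim p phi0 r))
  (D : 'I_b -> forall N : nat, {set 'I_N})
  (S : 'I_b -> forall N : nat, {set {set 'I_N}})
  (M : R) (s : nat -> R) (sa : 'I_b -> nat -> R)
  (b_gt0 : (0 < b)%N)
  (dim_gt0 : (0 < glmm_dim p phi0 r)%N)
  (Theta_convex : convex_set Theta)
  (modelP : forall N, is_glmm (model N) Theta)
  (S_partition : forall a N, finset.partition (S a N) (D a N))
  (A1_independent : forall a N theta, Theta theta ->
    independent_clusters (model N) (S a N) theta)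
  (A1_card : forall a, #|S a N| @[N --> \oo] --> \oo)
  (M_gt0 : 0 < M)
  (B2_interior : Theta° theta0)
  (B2_limsup : forall e : R, 0 < e ->
    (limn_esup (fun N =>
      ereal_sup [set
        \big[mine/+oo]_(a < b)
          ((#|S a N|%:R^-1)%:E *
           \sum_(C in S a N)
             'E_(law (model N) theta0)
               [fun w => log_ratio (model N) C theta theta0
                           (resp (model N) w)])
        | theta in [set theta | Theta theta /\
                                (e <= enorm (theta - theta0) <= M)%R]])
     < 0)%E)
  (B3_partials : forall N,
    {ae law (model N) theta0, forall w, forall theta,
      Theta theta -> enorm (theta - theta0) <= M ->
      forall C : {set 'I_N},
        C = [set: 'I_N]%SET \/ (exists a, C \in S a N) ->
        log_density_has_partials (model N) Theta C theta (resp (model N) w)})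
  (B3_s_gt0 : forall N, 0 < s N)
  (B3_sa_gt0 : forall a N, 0 < sa a N)
  (* in dimension > 1 the factor sa ^ (d - 1) is meant to be bounded below *)
  (B3_sa_away0 : (1 < glmm_dim p phi0 r)%N -> forall a,
    exists2 k : R, 0 < k & \forall N \near \oo, k <= sa a N)
  (B3_score : bigO_P (fun N => law (model N) theta0)
    (fun N w => ereal_sup [set
        (score_norm (model N) Theta [set: 'I_N]%SET theta
           (resp (model N) w))%:E
      | theta in [set theta | Theta theta /\ enorm (theta - theta0) <= M]])
    s)
  (* since b > 0, the default value of the minimum is immaterial *)
  (B3_log_s :
    ln (s N) / (\big[minn / (\max_(a < b) #|S a N|)%N]_(a < b) #|S a N|)%:R
      @[N --> \oo] --> 0)
  (B3_score_clusters : forall a, littleo_P (fun N => law (model N) theta0)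
    (fun N w => ereal_sup [set
        (#|S a N|%:R^-1 *
         \sum_(C in S a N)
           score_norm (model N) Theta C theta (resp (model N) w))%:E
      | theta in [set theta | Theta theta /\ enorm (theta - theta0) <= M]])
    (sa a))
  (B3_log_sa : forall a, ln (sa a N) / #|S a N|%:R @[N --> \oo] --> 0)
  (B3_variance : forall a,
    (ereal_sup [set
        (sa a N ^+ (glmm_dim p phi0 r).-1 / #|S a N|%:R ^+ 2)%:E *
        \sum_(C in S a N)
          'V_(law (model N) theta0)
            [fun w => log_ratio (model N) C theta theta0 (resp (model N) w)]
      | theta in [set theta | Theta theta /\ (enorm (theta - theta0) <= M)%R]]
     @[N --> \oo] --> 0)%E) :
  exists thetahat :
      forall N : nat, N.-tuple R -> 'rV[R]_(glmm_dim p phi0 r),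
    with_probability_tending_to_one (fun N => law (model N) theta0)
      (fun N => [set w |
        likelihood_root (model N) Theta (resp (model N) w)
          (thetahat N (resp (model N) w))]) /\
    forall e : R, 0 < e ->
      tends_to_zero_in_outer_probability (fun N => law (model N) theta0)
        (fun N => [set w |
          e < enorm (thetahat N (resp (model N) w) - theta0)]).
Proof.
have [rmax rmax0 small] := interior_cube dim_gt0 M_gt0 B2_interior.
have roots rho : 0 < rho -> rho <= rmax ->
    tends_to_zero_in_outer_probability (fun N => law (model N) theta0)
    (fun N => [set w | ~ exists2 theta, `|theta - theta0| <= rho &
      likelihood_root (model N) Theta (resp (model N) w) theta]).
  move=> rho0 /small[rhoM cube].
  exact: (likelihood_root_in_cube b_gt0 dim_gt0 modelP A1_independent A1_card
    B2_limsup B3_partials B3_s_gt0 B3_sa_gt0 B3_sa_away0 B3_score B3_log_s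
    B3_score_clusters B3_variance rho0 rhoM cube).
have hat_ex N (y : N.-tuple R) : exists t,
    likelihood_root (model N) Theta y !=set0 ->
    likelihood_root (model N) Theta y t /\
    forall theta, likelihood_root (model N) Theta y theta ->
      `|t - theta0| <= `|theta - theta0| + N.+1%:R^-1.
  exact: (near_minimizer _ (f := fun t => `|t - theta0|)).
pose thetahat N (y : N.-tuple R) := sval (cid (hat_ex N y)).
have hatP N (y : N.-tuple R) := svalP (cid (hat_ex N y)).
exists thetahat; split.
  apply: outer_tends_to_zeroS (roots _ rmax0 (lexx _)).
  apply: nearW => N w /= noroot [theta _ root]; apply: noroot.
  by have [|+ _] := hatP N (resp (model N) w); first by exists theta.
move=> e e0; pose d := glmm_dim p phi0 r.
have dR : 0 < d%:R :> R by rewrite ltr0n.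
have e2d : 0 < e / 2 / d%:R by rewrite !divr_gt0.
pose rho := Num.min rmax (e / 2 / d%:R).
have rho0 : 0 < rho by rewrite lt_min rmax0.
apply: outer_tends_to_zeroS (roots _ rho0 _); last by rewrite ge_min lexx.
near=> N => w /= far [theta th root].
have [|_ near_min] := hatP N (resp (model N) w); first by exists theta.
have hat_le := near_min _ root.
have inv_le : N.+1%:R^-1 <= e / 2 / d%:R :> R.
  by apply: ltW; near: N; exact: (near_infty_natSinv_lt (PosNum e2d)).
move: far; apply/negP; rewrite -leNgt; apply: le_trans (enorm_le_norm _) _.
rewrite mulrC -ler_pdivlMr// (le_trans hat_le)//.
have -> : e / d%:R = e / 2 / d%:R + e / 2 / d%:R by rewrite -mulrDl -splitr.
by rewrite lerD// (le_trans th)// ge_min lexx orbT.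
Unshelve. all: by end_near. Qed.
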